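(* Let $\mathbb{H}$ be a real separable Hilbert space and let $Z$ be a centered Gaussian process in $\mathbb{H}$ with covariance operator $C$, i.e. $Z\sim\mathcal{N}(0,C)$. Let $\mathcal{H}\subset\mathbb{H}$ denote the Cameron–Martin space (reproducing kernel Hilbert space) of $Z$, with norm $\|\cdot\|_{\mathcal{H}}$. Let $\mathcal{D}$ be the set of datasets of size $n$, where $D,D'\in\mathcal{D}$ are adjacent ($D\sim D'$) if they differ in exactly one element. Let $h:\mathcal{D}\to\mathbb{H}$ be a summary that is compatible with $Z$, i.e. $h(D)\in\mathcal{H}$ for every $D\in\mathcal{D}$, and suppose its global sensitivity $$\Delta:=\sup_{D\sim D'}\|h(D)-h(D')\|_{\mathcal{H}}$$ is finite. Let $\mu>0$ and $\sigma\geq \Delta/\mu$. Then the mechanism $\tilde h(D)=h(D)+\sigma Z$ is $\mu$-Gaussian differentially private.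
   Context: For probability distributions $U_1,U_2$ on a common space, the trade-off function $T(U_1,U_2):[0,1]\to[0,1]$ is $T(U_1,U_2)(\alpha)=\inf_\zeta\{\beta_\zeta:\alpha_\zeta\le\alpha\}$, where the infimum is over (possibly randomized) rejection rules $\zeta$ for testing $H_0:U_1$ versus $H_1:U_2$, $\alpha_\zeta$ is the type I error and $\beta_\zeta$ the type II error of $\zeta$. Let $G_\mu:=T(N(0,1),N(\mu,1))$. A randomized mechanism $\tilde h$ is $\mu$-Gaussian differentially private ($\mu$-GDP) if for all adjacent datasets $D\sim D'$, $T(\mathrm{Law}(\tilde h(D)),\mathrm{Law}(\tilde h(D')))(\alpha)\ge G_\mu(\alpha)$ for all $\alpha\in[0,1]$. *)

(* Defs.v *)
From HB Require Import structures.
From mathcomp Require Import all_boot all_order all_algebra.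
From mathcomp Require Import all_classical all_reals all_analysis.
Set Implicit Arguments. Unset Strict Implicit. Unset Printing Implicit Defensive.
Import Order.TTheory GRing.Theory Num.Theory.
Import numFieldNormedType.Exports.
Local Open Scope classical_set_scope.
Local Open Scope ring_scope.

Section defs.
Context {R : realType}.

Definition is_inner_product (H : normedModType R) (ip : H -> H -> R) : Prop :=
  [/\ (forall x y, ip x y = ip y x),
      (forall (a : R) (x y z : H), ip (a *: x + y) z = a * ip x z + ip y z) &
      (forall x, ip x x = `|x| ^+ 2)].

Definition separable_space (H : topologicalType) : Prop :=
  exists S : set H, countable S /\ closure S = setT.

Definition borel (H : normedModType R) := g_sigma_algebraType (@open H).

Definition centered_normal (v : R) : set R -> \bar R :=
  if v == 0 then \d_(0 : R) else normal_prob 0 (Num.sqrt v).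

Definition centered_gaussian (H : normedModType R) (ip : H -> H -> R)
  d (Omega : measurableType d) (P : probability Omega R)
  (Z : Omega -> H) (C : H -> H) : Prop :=
  [/\ @measurable_fun _ _ Omega (borel H) setT Z,
      (forall x : H, forall A : set R, measurable A ->
         pushforward P (fun w => ip (Z w) x) A = centered_normal (ip (C x) x) A) &
      (forall x y : H,
         (\int[P]_w ((ip (Z w) x) * (ip (Z w) y))%:E)%E = (ip (C x) y)%:E)].

(** Cameron--Martin norm |h|_CM = sup { <h,x> : <C x, x> <= 1 } (in \bar R);
    the Cameron--Martin space is { h | |h|_CM < +oo }. *)
Definition cm_norm (H : normedModType R) (ip : H -> H -> R) (C : H -> H)
  (h : H) : \bar R :=
  ereal_sup [set (ip h x)%:E | x in [set x : H | ip (C x) x <= 1]].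

Definition adjacent_datasets (X : Type) (n : nat) (D D' : 'I_n -> X) : Prop :=
  exists i : 'I_n, D i <> D' i /\ (forall j, j <> i -> D j = D' j).

Definition sensitivity (H : normedModType R) (ip : H -> H -> R) (C : H -> H)
  (X : Type) (n : nat) (h : ('I_n -> X) -> H) : \bar R :=
  ereal_sup [set cm_norm ip C (h DD.1 - h DD.2) |
             DD in [set DD : ('I_n -> X) * ('I_n -> X) | adjacent_datasets DD.1 DD.2]].

(** trade-off function T(U1,U2)(alpha): infimum of the type II error
    E_{U2}[1 - phi] over randomized rejection rules phi : T -> [0,1]
    (measurable) with type I error E_{U1}[phi] <= alpha. *)
Definition tradeoff d (T : measurableType d) (U1 U2 : set T -> \bar R)
  (alpha : R) : \bar R :=
  ereal_inf [set (\int[U2]_t (1 - phi t)%:E)%E |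
    phi in [set phi : T -> R | [/\ measurable_fun setT phi,
                                   (forall t, 0 <= phi t <= 1) &
                                   (\int[U1]_t (phi t)%:E <= alpha%:E)%E]]].

Definition G_tradeoff (mu : R) (alpha : R) : \bar R :=
  tradeoff (normal_prob (0 : R) 1) (normal_prob mu 1) alpha.

Definition is_GDP (Dset : Type) (adj : Dset -> Dset -> Prop)
  d (T : measurableType d) (law : Dset -> set T -> \bar R) (mu : R) : Prop :=
  forall D D', adj D D' -> forall alpha : R, 0 <= alpha <= 1 ->
    (G_tradeoff mu alpha <= tradeoff (law D) (law D') alpha)%E.

End defs.

(* Main.v *)
(** A lower bound on the trade-off function at level [alpha]
    follows from [E phi(Z + delta) - k E phi(Z) <= np_excess k mu] for all [k > 0] and all tests
    [phi], where [np_excess k mu] is the Neyman-Pearson optimum of the left-hand side for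
    [N(mu, 1)] against [N(0, 1)].  For a trigonometric polynomial [phi] the shift by the
    covariance direction of [x] is the change of density [exp (s <Z, x> - s^2 <C x, x> / 2)],
    because exponential moments determine the integrals of cosines, and this density depends on
    the one-dimensional Gaussian [<Z, x>] only.  A near-maximizer [x] of [<delta, .>] on
    [<C x, x> <= 1] makes that direction as close to [delta] as desired on finitely many
    frequencies.  Trigonometric tests are [L^1]-dense among Borel tests for any finite measure on
    a separable Hilbert space, which gives all tests. *)

Require Import Defs.
From HB Require Import structures.
From mathcomp Require Import all_boot all_order all_algebra.
From mathcomp Require Import all_classical all_reals all_analysis.
From mathcomp Require Import measurable_realfun ring lra.
Import Order.TTheory GRing.Theory Num.Theory.
Import numFieldNormedType.Exports.
Local Open Scope classical_set_scope.
Local Open Scope ring_scope.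
Set Implicit Arguments.
Unset Strict Implicit.
Unset Printing Implicit Defensive.

(** * Determinacy by exponential moments *)

(** The obstacle is that [C] is only a map tied to [Z] by covariance integrals, and that the shift
    [delta] is known only through upper bounds on [ip delta x]: it need not be a value of [C], so no
    explicit density is available for the shifted law. Explicit densities exist for shifts by
    [s *: C x], and these are compared with [delta] one cosine at a time. The multiplier form of the
    testing problem is what survives the successive approximations: it is linear in the test and
    continuous in [L^1] for the sum of the two laws, whereas a constraint on the level would be
    disturbed each time the test is replaced. Linearity also carries the bound from single cosines
    to polynomials and from indicators of sets to randomized tests. Only the Cameron-Martin norm of
    [delta] itself can be nearly attained, while the claim concerns the possibly larger [mu];
    monotonicity of the one-dimensional optimum in the shift bridges the two. *)

Section power_series.
Context {R : realType}.
Implicit Type e : R^nat.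

Lemma sumr_expr_le2 (x : R) n : 0 <= x <= 2^-1 -> \sum_(0 <= i < n) x ^+ i <= 2.
Proof.
move=> /andP[x0 x1].
suff : \sum_(0 <= i < n) x ^+ i <= 2 - 2 * x ^+ n.
  by move/le_trans; apply; rewrite lerBlDr lerDl mulr_ge0// exprn_ge0.
elim: n => [|n ih]; first by rewrite big_nil expr0; lra.
rewrite big_nat_recr//= exprS.
have := exprn_ge0 n x0; nra.
Qed.

(** Convergence at 1 bounds the coefficients by some [K], so the tail beyond [e 0] is at most
    [2 * K * x] for small [x > 0]. The point [x = 0] is left out of the hypothesis so that it is
    inherited after a division by [x]. *)
Lemma pseries_cvg0_coef0 e :
  (forall x, x != 0 -> pseries e x @ \oo --> 0) -> e 0%N = 0.
Proof.
move=> h.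
have h1 := h 1 (oner_neq0 _).
have [K K0 eK] : exists2 K, 0 < K & forall n, `|e n| <= K.
  have h1' : cvgn (series (fun i => e i * 1 ^+ i)) by apply/cvg_ex; exists 0.
  have [M [Mreal MP]] := cvg_series_bounded h1'.
  exists (`|M| + 1); first by rewrite ltr_pwDr.
  move=> n.
  have := MP (`|M| + 1); rewrite ltr_pwDr ?ler_norm// => /(_ isT n I).
  by rewrite /= expr1n mulr1.
have key x : 0 < x -> x <= 2^-1 -> `|e 0%N| <= 2 * K * x.
  move=> x0 x1.
  have hx := h x (lt0r_neq0 x0).
  have : `|e 0%N - pseries e x n| @[n --> \oo] --> `|e 0%N - 0|.
    by apply: cvg_norm; apply: cvgB => //; exact: cvg_cst.
  rewrite subr0 => hc.
  rewrite -(cvg_lim _ hc)//; apply: limr_le; first by apply/cvg_ex; eexists; exact: hc.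
  near=> n.
  have [m ->] : exists m, n = m.+1.
    by exists n.-1; rewrite prednK//; near: n; exists 1%N.
  rewrite /pseries /series/= big_nat_recl//= expr0 mulr1 opprD addrA subrr sub0r normrN.
  rewrite (le_trans (ler_norm_sum _ _ _))//.
  rewrite (@le_trans _ _ (\sum_(0 <= i < m) (K * x) * x ^+ i))//.
    apply: ler_sum => i _; rewrite normrM normrX (gtr0_norm x0) exprS mulrA.
    by rewrite ler_wpM2r ?exprn_ge0 ?(ltW x0)// ler_wpM2r ?(ltW x0).
  rewrite -mulr_sumr (_ : 2 * K * x = K * x * 2); last by ring.
  rewrite ler_wpM2l//.
    by rewrite mulr_ge0 ?ltW.
  by rewrite sumr_expr_le2// (ltW x0).
apply/eqP/negPn/negP => e0.
have e0' : 0 < `|e 0%N| by rewrite normr_gt0.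
(* The second argument makes [2 * K * x] at most half of [|e 0|], the first keeps the geometric sum
   below 2. *)
pose x := Num.min 2^-1 (`|e 0%N| / (4 * K)).
have x0 : 0 < x by rewrite lt_min invr_gt0 ltr0n/= divr_gt0// mulr_gt0.
have := key x x0; rewrite ge_min lexx/= => /(_ isT).
apply/negP; rewrite -ltNge.
have : x <= `|e 0%N| / (4 * K) by rewrite ge_min lexx orbT.
rewrite ler_pdivlMr ?mulr_gt0// => ?; lra.
Unshelve. all: by end_near. Qed.

(** Once [e 0 = 0], dividing the partial sums by [x] gives those of the shifted sequence, to which
    the induction applies. *)
Lemma pseries_cvg0_coef e :
  (forall x, x != 0 -> pseries e x @ \oo --> 0) -> forall n, e n = 0.
Proof.
move=> h n; elim: n e h => [|n ih] e h; first exact: pseries_cvg0_coef0.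
apply: (ih (fun i => e i.+1)) => x x0.
have e0 := pseries_cvg0_coef0 h.
have : x^-1 * pseries e x k.+1 @[k --> \oo] --> x^-1 * 0.
  apply: cvgM; first exact: cvg_cst.
  by rewrite cvg_shiftS; exact: h.
rewrite mulr0; apply: cvg_trans; apply: near_eq_cvg; near=> k.
rewrite /pseries /series/= big_nat_recl//= e0 mul0r add0r mulr_sumr.
by apply: eq_bigr => i _; rewrite exprS mulrCA mulKf.
Unshelve. all: by end_near. Qed.

End power_series.

Section exponential_moments.
Context d (T : measurableType d) (R : realType).
Variable P : {measure set T -> \bar R}.
Implicit Types (f g w W : T -> R) (b : R).

Lemma Rintegral_dominated_cvg (f_ : nat -> T -> R) f g :
  (forall n, measurable_fun setT (f_ n)) -> measurable_fun setT f ->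
  (forall t, f_ n t @[n --> \oo] --> f t) ->
  P.-integrable setT (EFin \o g) -> (forall n t, `|f_ n t| <= g t) ->
  \int[P]_t f_ n t @[n --> \oo] --> \int[P]_t f t.
Proof.
move=> mf_ mf ff ig fg.
have ae1 : {ae P, forall t, setT t -> (f_ n t)%:E @[n --> \oo] --> (f t)%:E}.
  by apply: aeW => t _; apply: cvg_EFin; [exact: nearW|exact: ff].
have ae2 : {ae P, forall t n, setT t -> `|(f_ n t)%:E| <= (g t)%:E}%E.
  by apply: aeW => t n _; rewrite lee_fin.
have [i1 _ h] := @dominated_convergence _ _ _ P setT measurableT
  (fun n t => (f_ n t)%:E) (EFin \o f) (EFin \o g)
  (fun n => (measurable_EFinP _ _).2 (mf_ n)) ((measurable_EFinP _ _).2 mf)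
  ae1 ig ae2.
apply: fine_cvg; rewrite fineK//.
exact: integrable_fin_num.
Qed.

Lemma integrable_le f g : measurable_fun setT f ->
  P.-integrable setT (EFin \o g) -> (forall t, `|f t| <= g t) ->
  P.-integrable setT (EFin \o f).
Proof.
move=> mf ig fg; apply: le_integrable ig => //; first exact/measurable_EFinP.
by move=> t _; rewrite !lee_fin (le_trans (fg t))// ler_norm.
Qed.

Lemma expR_normr_le (x : R) : expR `|x| <= expR x + expR (- x).
Proof.
by case: (ger0P x) => _; rewrite ?lerDl ?lerDr expR_ge0.
Qed.

(** A bound independent of [n], by a function that exponential moments of both signs make
    integrable: the domination used to exchange series and integral. *)
Lemma partial_expR_le (c : R^nat) (x : R) n :
  (forall j, `|c j| <= (j`!%:R)^-1) -> `|pseries c x n| <= expR x + expR (- x).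
Proof.
move=> hc; rewrite (le_trans _ (expR_normr_le x))//.
rewrite /pseries /series/= (le_trans (ler_norm_sum _ _ _))//.
rewrite (@le_trans _ _ (series (exp_coeff `|x|) n))//.
  apply: ler_sum => i _; rewrite normrM normrX /exp_coeff/= mulrC.
  by rewrite ler_wpM2l ?exprn_ge0.
apply: nondecreasing_cvgn_le; last exact: is_cvg_series_exp_coeff.
by apply: nondecreasing_series => i _ _; exact: exp_coeff_ge0.
Qed.

Variables (w W : T -> R).
Hypotheses (mw : measurable_fun setT w) (mW : measurable_fun setT W).
Hypothesis w0 : forall t, 0 <= w t.
Hypothesis mgf : forall b, P.-integrable setT (EFin \o (fun t => w t * expR (b * W t))).

Let dominating b : P.-integrable setT
  (EFin \o (fun t => w t * (expR (b * W t) + expR (- (b * W t))))).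
Proof.
have := integrableD measurableT (mgf b) (mgf (- b)).
by apply: eq_integrable => // t _; rewrite /= -EFinD mulrDr mulNr.
Qed.

Lemma integrable_moment n : P.-integrable setT (EFin \o (fun t => w t * W t ^+ n)).
Proof.
apply: (@integrable_le _ (fun t => n`!%:R * (w t * (expR (1 * W t) + expR (- (1 * W t)))))).
- by apply: measurable_funM => //; exact: measurable_funX.
- have := integrableZl measurableT n`!%:R (dominating 1).
  by apply: eq_integrable.
move=> t; rewrite mul1r normrM (ger0_norm (w0 t)) mulrCA ler_wpM2l//.
rewrite -ler_pdivrMl ?ltr0n ?fact_gt0//.
rewrite (le_trans _ (expR_normr_le (W t)))// normrX.
case: n => [|n].
  by rewrite expr0 mulr1 fact0 invr1 -expR0 ler_expR.
rewrite (le_trans _ (expR_ge1Dxn n (normr_ge0 (W t))))// mulrC.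
by rewrite lerDr.
Qed.

(** Left general in [F] because it is used three times: with [exp] it identifies the moments as
    Taylor coefficients of the exponential moments, and with [cos] and [sin] it recovers
    trigonometric integrals from the moments. *)
Lemma moment_series (c : R^nat) (F : R -> R) b :
  (forall j, `|c j| <= (j`!%:R)^-1) ->
  (forall x, pseries c x @ \oo --> F x) -> measurable_fun setT F ->
  pseries (fun j => c j * \int[P]_t (w t * W t ^+ j)) b @ \oo -->
    \int[P]_t (w t * F (b * W t)).
Proof.
move=> hc cF mF.
have mp n : measurable_fun setT (fun t => pseries c (b * W t) n).
  apply: measurable_sum => i; apply: measurable_funM => //.
  by apply: measurable_funX => //; exact: measurable_funM.
have e n : pseries (fun j => c j * \int[P]_t (w t * W t ^+ j)) b n =
    \int[P]_t (w t * pseries c (b * W t) n).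
  rewrite /pseries /series/=.
  have -> : \int[P]_t (w t * \sum_(0 <= k < n) c k * (b * W t) ^+ k) =
      \int[P]_t (\sum_(0 <= k < n) (c k * b ^+ k) * (w t * W t ^+ k)).
    apply: eq_Rintegral => t _; rewrite mulr_sumr; apply: eq_bigr => i _.
    by rewrite exprMn; ring.
  have ik k : P.-integrable setT (EFin \o (fun t => (c k * b ^+ k) * (w t * W t ^+ k))).
    have := integrableZl measurableT (c k * b ^+ k) (integrable_moment k).
    exact: eq_integrable.
  suff : P.-integrable setT (EFin \o (fun t => \sum_(0 <= k < n) (c k * b ^+ k) * (w t * W t ^+ k)))
    /\ \sum_(0 <= k < n) c k * \int[P]_t (w t * W t ^+ k) * b ^+ k =
      \int[P]_t \sum_(0 <= k < n) c k * b ^+ k * (w t * W t ^+ k) by case.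
  elim: n => [|n [ih1 ih2]].
    under [X in integrable _ _ (EFin \o X)]eq_fun do rewrite big_nil.
    split; first exact: integrable0.
    rewrite big_nil; under eq_Rintegral do rewrite big_nil.
    by rewrite Rintegral_cst// mul0r.
  split.
    have := integrableD measurableT ih1 (ik n).
    by apply: eq_integrable => // t _; rewrite /= big_nat_recr.
  under eq_Rintegral do rewrite big_nat_recr//=.
  rewrite RintegralD// -ih2 big_nat_recr//=; congr (_ + _).
  by rewrite RintegralZl//; [ring|exact: integrable_moment].
under eq_cvg do rewrite e.
apply: (Rintegral_dominated_cvg _ _ _ (dominating b)).
- by move=> n; exact: measurable_funM.
- apply: measurable_funM => //; apply: measurableT_comp => //.
  exact: measurable_funM.
- by move=> t; apply: cvgM; [exact: cvg_cst|exact: cF].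
- move=> n t; rewrite normrM (ger0_norm (w0 t)) ler_wpM2l//.
  exact: partial_expR_le.
Qed.

End exponential_moments.

Section mgf_uniqueness.
Context d (T : measurableType d) (R : realType).
Variable P : {measure set T -> \bar R}.
Variables (w1 W1 w2 W2 : T -> R).
Hypotheses (mw1 : measurable_fun setT w1) (mW1 : measurable_fun setT W1).
Hypotheses (mw2 : measurable_fun setT w2) (mW2 : measurable_fun setT W2).
Hypotheses (w10 : forall t, 0 <= w1 t) (w20 : forall t, 0 <= w2 t).
Hypothesis i1 : forall b, P.-integrable setT (EFin \o (fun t => w1 t * expR (b * W1 t))).
Hypothesis i2 : forall b, P.-integrable setT (EFin \o (fun t => w2 t * expR (b * W2 t))).
Hypothesis mgf12 : forall b,
  \int[P]_t (w1 t * expR (b * W1 t)) = \int[P]_t (w2 t * expR (b * W2 t)).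

(** Both exponential moments are everywhere convergent power series in [b] with coefficients moment
    over [n!], so equal sums force equal coefficients. *)
Lemma eq_moment n : \int[P]_t (w1 t * W1 t ^+ n) = \int[P]_t (w2 t * W2 t ^+ n).
Proof.
pose c j : R := (j`!%:R)^-1.
have c1 j : `|c j| <= (j`!%:R)^-1 by rewrite ger0_norm// invr_ge0.
have ce x : pseries c x @ \oo --> expR x.
  by rewrite /pseries -exp_coeffE; exact: is_cvg_series_exp_coeff.
have me : measurable_fun setT (@expR R) by [].
pose e j := c j * \int[P]_t (w1 t * W1 t ^+ j) - c j * \int[P]_t (w2 t * W2 t ^+ j).
have e0 j : e j = 0.
  move: j; apply: pseries_cvg0_coef => x _.
  have h1 := moment_series mw1 mW1 w10 i1 (b := x) c1 ce me.
  have h2 := moment_series mw2 mW2 w20 i2 (b := x) c1 ce me.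
  rewrite mgf12 in h1.
  have -> : pseries e x = pseries (fun j => c j * \int[P]_t (w1 t * W1 t ^+ j)) x -
      pseries (fun j => c j * \int[P]_t (w2 t * W2 t ^+ j)) x.
    apply/funext => k; rewrite /pseries /series/= !fctE -sumrB.
    by apply: eq_bigr => i _; rewrite -mulrBl.
  have -> : 0 = \int[P]_t (w2 t * expR (x * W2 t)) - \int[P]_t (w2 t * expR (x * W2 t)) by rewrite subrr.
  exact: cvgB.
have /eqP := e0 n; rewrite /e subr_eq0 => /eqP /mulfI; apply.
by rewrite invr_eq0 pnatr_eq0 -lt0n fact_gt0.
Qed.

Let eq_pseries_integral (c : R^nat) (F : R -> R) :
  (forall j, `|c j| <= (j`!%:R)^-1) ->
  (forall x, pseries c x @ \oo --> F x) -> measurable_fun setT F ->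
  \int[P]_t (w1 t * F (W1 t)) = \int[P]_t (w2 t * F (W2 t)).
Proof.
move=> hc cF mF.
have h1 := moment_series mw1 mW1 w10 i1 (b := 1) hc cF mF.
have h2 := moment_series mw2 mW2 w20 i2 (b := 1) hc cF mF.
under eq_Rintegral do rewrite -[W1 _]mul1r.
under [RHS]eq_Rintegral do rewrite -[W2 _]mul1r.
rewrite -(cvg_lim _ h1)// -(cvg_lim _ h2)//; congr (limn _).
apply/funext => n; rewrite /pseries /series/=.
by apply: eq_bigr => i _; rewrite eq_moment.
Qed.

(** The phase is split off by the addition formula, which leaves [cos] and [sin], two series whose
    coefficients are bounded by [1 / n!]. *)
Lemma mgf_eq_cos theta :
  \int[P]_t (w1 t * cos (W1 t + theta)) = \int[P]_t (w2 t * cos (W2 t + theta)).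
Proof.
have ecos : \int[P]_t (w1 t * cos (W1 t)) = \int[P]_t (w2 t * cos (W2 t)).
  apply: (@eq_pseries_integral (fun n => (~~ odd n)%:R * (-1) ^+ n./2 * (n`!%:R)^-1)).
  - move=> j; rewrite !normrM normrX normrN1 expr1n mulr1 ger0_norm//.
    rewrite ger0_norm ?invr_ge0// ler_piMl ?invr_ge0//.
    by case: odd.
  - move=> x; rewrite /pseries -cos_coeffE unlock.
    exact: is_cvg_series_cos_coeff.
  - by apply: continuous_measurable_fun; exact: continuous_cos.
have esin : \int[P]_t (w1 t * sin (W1 t)) = \int[P]_t (w2 t * sin (W2 t)).
  apply: (@eq_pseries_integral (fun n => (odd n)%:R * (-1) ^+ n.-1./2 * (n`!%:R)^-1)).
  - move=> j; rewrite !normrM normrX normrN1 expr1n mulr1 ger0_norm//.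
    rewrite ger0_norm ?invr_ge0// ler_piMl ?invr_ge0//.
    by case: odd.
  - move=> x; rewrite /pseries -sin_coeffE unlock.
    exact: is_cvg_series_sin_coeff.
  - by apply: continuous_measurable_fun; exact: continuous_sin.
have mcos : measurable_fun setT (@cos R).
  by apply: continuous_measurable_fun; exact: continuous_cos.
have msin : measurable_fun setT (@sin R).
  by apply: continuous_measurable_fun; exact: continuous_sin.
have bint (w W : T -> R) (F : R -> R) : measurable_fun setT w -> measurable_fun setT W ->
    measurable_fun setT F -> (forall t, 0 <= w t) -> (forall x, `|F x| <= 1) ->
    P.-integrable setT (EFin \o (fun t => w t * expR (0 * W t))) ->
    P.-integrable setT (EFin \o (fun t => w t * F (W t))).
  move=> mw mW mF w0 F1 iw; apply: (integrable_le _ iw).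
    by apply: measurable_funM => //; exact: measurableT_comp.
  by move=> t; rewrite mul0r expR0 mulr1 normrM (ger0_norm (w0 t)) ler_piMr.
have cos1 (x : R) : `|cos x| <= 1 by rewrite ler_norml cos_geN1 cos_le1.
have sin1 (x : R) : `|sin x| <= 1 by rewrite ler_norml sin_geN1 sin_le1.
have split_cos (w W : T -> R) : measurable_fun setT w -> measurable_fun setT W ->
    (forall t, 0 <= w t) ->
    P.-integrable setT (EFin \o (fun t => w t * expR (0 * W t))) ->
    \int[P]_t (w t * cos (W t + theta)) =
    cos theta * \int[P]_t (w t * cos (W t)) - sin theta * \int[P]_t (w t * sin (W t)).
  move=> mw mW w0 iw.
  have ic := bint w W _ mw mW mcos w0 cos1 iw.
  have ins := bint w W _ mw mW msin w0 sin1 iw.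
  rewrite -!RintegralZl// -RintegralB//; first last.
  - exact: eq_integrable (integrableZl measurableT (sin theta) ins).
  - exact: eq_integrable (integrableZl measurableT (cos theta) ic).
  by apply: eq_Rintegral => t _; rewrite cosD; ring.
by rewrite !split_cos// ecos esin.
Qed.

End mgf_uniqueness.

(** * Density of an algebra of tests *)

Section threshold.
Context {R : realType}.
Implicit Types x u q r : R.

Lemma ge0_bernoulli x n : 0 <= x <= 1 -> 1 - n%:R * x <= (1 - x) ^+ n.
Proof.
move=> /andP[x0 x1]; elim: n => [|n ih]; first by rewrite mul0r subr0 expr0.
rewrite exprS (le_trans _ (ler_wpM2l _ ih)) ?subr_ge0//.
have : 0 <= n%:R * x ^+ 2 by rewrite mulr_ge0// exprn_ge0.
rewrite -natr1; nra.
Qed.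

Lemma expr_onem_le x n : 0 <= x <= 1 -> (1 - x) ^+ n <= (1 + n%:R * x)^-1.
Proof.
move=> /andP[x0 x1].
have p k : 0 < 1 + k%:R * x by rewrite ltr_pwDl// mulr_ge0.
rewrite -[leRHS]mul1r ler_pdivlMr//.
elim: n => [|n ih]; first by rewrite expr0 mul0r addr0 mulr1.
rewrite exprS mulrAC (le_trans _ ih)//.
rewrite [leRHS]mulrC ler_wpM2r ?exprn_ge0 ?subr_ge0//.
have : 0 <= n.+1%:R * x ^+ 2 by rewrite mulr_ge0// exprn_ge0.
rewrite -natr1; nra.
Qed.

(** With [r = (1 + q) / 2] one has [q <= r ^+ 2], as the difference is a quarter of [(1 - q) ^+ 2].
    One factor [r ^+ n] absorbs [n], since [n * r ^+ n] is at most the geometric sum, and the other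
    tends to 0. *)
Lemma cvg_natr_expr q : 0 <= q < 1 -> n%:R * q ^+ n @[n --> \oo] --> (0 : R).
Proof.
move=> /andP[q0 q1]; pose r := (1 + q) / 2.
have r1 : r < 1 by rewrite /r; lra.
have r0 : 0 < r by rewrite /r; lra.
have qr : q <= r ^+ 2 by rewrite /r; have := sqr_ge0 (1 - q); lra.
have key n : n%:R * r ^+ n <= (1 - r)^-1.
  rewrite -[leRHS]mul1r ler_pdivlMr ?subr_gt0//.
  suff : n%:R * r ^+ n * (1 - r) <= 1 - r ^+ n.
    by move/le_trans; apply; rewrite lerBlDr lerDl exprn_ge0// ltW.
  elim: n => [|n ih]; first by rewrite !mul0r expr0 subrr.
  rewrite exprS -natr1.
  have p0 : 0 <= r ^+ n by rewrite exprn_ge0// ltW.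
  have p1 : r ^+ n <= 1 by rewrite exprn_ile1 ?ltW.
  set p := r ^+ n in ih p0 p1 *; set a := n%:R * p in ih *.
  have -> : (n%:R + 1) * (r * p) * (1 - r) = r * (a * (1 - r)) + r * p * (1 - r).
    by rewrite /a; ring.
  have : r * (a * (1 - r)) <= r * (1 - p) by apply: ler_wpM2l ih; exact: ltW.
  have : 0 <= (1 - r) * (1 - r * p).
    by apply: mulr_ge0; rewrite subr_ge0 ?(ltW r1)// (mulr_ile1 (ltW r0) p0 (ltW r1) p1).
  nra.
apply: (@squeeze_cvgr _ _ _ _ (cst 0) (fun n => (1 - r)^-1 * r ^+ n)).
- near=> n; rewrite mulr_ge0 ?exprn_ge0//=.
  rewrite (@le_trans _ _ (n%:R * r ^+ n * r ^+ n))//.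
    by rewrite -mulrA -exprD addnn -mul2n exprM ler_wpM2l// lerXn2r// nnegrE ?exprn_ge0 ?(ltW r0).
  by rewrite ler_wpM2r ?exprn_ge0 ?(ltW r0).
- exact: cvg_cst.
- rewrite -[X in _ --> X](mulr0 (1 - r)^-1); apply: cvgM; first exact: cvg_cst.
  by apply: cvg_expr; rewrite gtr0_norm.
Unshelve. all: by end_near. Qed.

(* As in Brosowski and Deutsch's proof of the Stone-Weierstrass theorem. *)
Lemma cvg_threshold u : 0 <= u <= 1 ->
  (1 - u ^+ n) ^+ (n * 2 ^ n) @[n --> \oo] --> ((u < 2^-1)%R%:R : R).
Proof.
move=> /andP[u0 u1].
have un n : 0 <= u ^+ n <= 1 by rewrite exprn_ge0// exprn_ile1.
(* The exponent [n * 2 ^ n] turns the Bernoulli term into [n * (2 * u) ^+ n]. It vanishes in the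
   limit for [u] below one half and is at least [n] from one half on, which is why the limit is the
   indicator of the strict inequality. *)
have e n : (n * 2 ^ n)%:R * u ^+ n = n%:R * (2 * u) ^+ n.
  by rewrite natrM natrX exprMn mulrA.
have [uh|uh] := ltrP u 2^-1.
  apply: (@squeeze_cvgr _ _ _ _ (fun n => 1 - n%:R * (2 * u) ^+ n) (cst 1)).
  - near=> n; rewrite -e ge0_bernoulli//= exprn_ile1 ?subr_ge0//.
    + by case/andP: (un n).
    + by rewrite lerBlDr lerDl; case/andP: (un n).
  - rewrite -[X in _ --> X]subr0; apply: cvgB; first exact: cvg_cst.
    by apply: cvg_natr_expr; lra.
  - exact: cvg_cst.
apply: (@squeeze_cvgr _ _ _ _ (cst 0) (fun n => n.+1%:R^-1)).
- near=> n; rewrite exprn_ge0/= ?subr_ge0//; last by case/andP: (un n).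
  rewrite (le_trans (expr_onem_le _ (un n)))// e.
  rewrite lef_pV2 ?posrE ?ltr_pwDl ?mulr_ge0 ?exprn_ge0 ?mulr_ge0//.
  rewrite -natr1 addrC lerD2l ler_peMr// exprn_ege1//.
  by have := uh; lra.
- exact: cvg_cst.
- exact: cvg_harmonic.
Unshelve. all: by end_near. Qed.

End threshold.

Section L1_approximation.
Context d (T : measurableType d) (R : realType).
Variables (m : {measure set T -> \bar R}) (A : set (T -> R)).
Hypothesis mfin : (m setT < +oo)%E.
Hypothesis mA : forall f, A f -> measurable_fun setT f.
Hypothesis A01 : forall f t, A f -> 0 <= f t <= 1.
Hypothesis A1 : A (cst 1).
Hypothesis AC : forall f, A f -> A (fun t => 1 - f t).
Hypothesis AM : forall f g, A f -> A g -> A (fun t => f t * g t).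
Implicit Types (f g h k l : T -> R) (S : set T).

Definition L1_approx f :=
  forall e : R, 0 < e -> exists2 g, A g & \int[m]_t `|f t - g t| <= e.

Definition approx_set S := measurable S /\ L1_approx \1_S.

Lemma bounded_integrable f (K : R) : measurable_fun setT f ->
  (forall t, `|f t| <= K) -> m.-integrable setT (EFin \o f).
Proof.
move=> mf f1; apply: measurable_bounded_integrable => //.
exists K; split; first exact: num_real.
by move=> x Kx t _; rewrite /= (le_trans (f1 t))// ltW.
Qed.

Let integrable_dist f g : measurable_fun setT f -> measurable_fun setT g ->
  (forall t, 0 <= f t <= 1) -> (forall t, 0 <= g t <= 1) ->
  m.-integrable setT (EFin \o (fun t => `|f t - g t|)).
Proof.
move=> mf mg f01 g01; apply: (@bounded_integrable _ 1).
  by apply: measurableT_comp => //; exact: measurable_funB.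
by move=> t; rewrite normr_id ler_norml; have := f01 t; have := g01 t; lra.
Qed.

Let dist_le f g h k l : measurable_fun setT f -> measurable_fun setT g ->
  measurable_fun setT h -> measurable_fun setT k -> measurable_fun setT l ->
  (forall t, 0 <= g t <= 1) -> (forall t, 0 <= h t <= 1) ->
  (forall t, 0 <= k t <= 1) -> (forall t, 0 <= l t <= 1) ->
  (forall t, `|f t| <= `|g t - h t| + `|k t - l t|) ->
  \int[m]_t `|f t| <= \int[m]_t `|g t - h t| + \int[m]_t `|k t - l t|.
Proof.
move=> mf mg mh mk ml g01 h01 k01 l01 H.
have i1 := integrable_dist mg mh g01 h01.
have i2 := integrable_dist mk ml k01 l01.
rewrite -RintegralD//; apply: le_Rintegral => //.
- apply: (@bounded_integrable _ 2); first exact: measurableT_comp.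
  move=> t; rewrite normr_id (le_trans (H t))//.
  rewrite (_ : 2 = 1 + 1)// lerD// ler_norml.
  + by have := g01 t; have := h01 t; lra.
  + by have := k01 t; have := l01 t; lra.
- exact: eq_integrable (integrableD measurableT i1 i2).
Qed.

Let indic01 S t : 0 <= (\1_S t : R) <= 1.
Proof. by rewrite indicE; case: (_ \in _); rewrite lexx ler01. Qed.

Lemma L1_approx_lim (f_ : nat -> T -> R) f :
  (forall n, measurable_fun setT (f_ n)) -> measurable_fun setT f ->
  (forall n t, 0 <= f_ n t <= 1) -> (forall t, 0 <= f t <= 1) ->
  (forall t, f_ n t @[n --> \oo] --> f t) ->
  (forall n, L1_approx (f_ n)) -> L1_approx f.
Proof.
move=> mf_ mf f_01 f01 ff hf e e0.
have /cvgrPdist_lt/(_ (e / 2)) : \int[m]_t `|f t - f_ n t| @[n --> \oo] --> \int[m]_t (cst 0 t : R).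
  apply: (@Rintegral_dominated_cvg _ _ _ m _ _ (cst 1)).
  - by move=> n; apply: measurableT_comp => //; exact: measurable_funB.
  - exact: measurable_cst.
  - move=> t; rewrite -[X in _ --> X](normr0 R) -(subrr (f t)).
    by apply: cvg_norm; apply: cvgB => //; exact: cvg_cst.
  - apply: (@bounded_integrable _ 1); first exact: measurable_cst.
    by move=> t /=; rewrite normr1.
  - by move=> n t; rewrite normr_id ler_norml /=; have := f01 t; have := f_01 n t; lra.
rewrite divr_gt0// => /(_ isT)[n _ /(_ n (leqnn n))].
rewrite Rintegral_cst// mul0r sub0r normrN ger0_norm; last exact: Rintegral_ge0.
move=> hn; have [|g Ag hg] := hf n (e / 2); first by rewrite divr_gt0.
exists g => //.
apply: (@le_trans _ _ (\int[m]_t `|f t - f_ n t| + \int[m]_t `|f_ n t - g t|)).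
  apply: dist_le => //.
  - exact: measurable_funB (mA Ag).
  - exact: mA.
  - by move=> t; exact: A01.
  - by move=> t; rewrite (le_trans _ (ler_normD _ _))// addrA subrK.
rewrite [leRHS]splitr; exact: lerD (ltW hn) hg.
Qed.

Lemma L1_approx_self f : A f -> L1_approx f.
Proof.
move=> Af e e0; exists f => //.
under eq_Rintegral do rewrite subrr normr0.
by rewrite Rintegral_cst// mul0r ltW.
Qed.

Lemma approx_setT : approx_set setT.
Proof.
split=> //; rewrite (_ : \1_setT = cst 1 :> (T -> R)); last first.
  by apply/funext => t; rewrite indicT.
exact: L1_approx_self.
Qed.

Lemma approx_setC S : approx_set S -> approx_set (~` S).
Proof.
move=> [mS hS]; split; first exact: measurableC.
move=> e e0; have [g Ag hg] := hS e e0.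
exists (fun t => 1 - g t); first exact: AC.
move: hg; congr (_ <= _); apply: eq_Rintegral => t _.
rewrite !indicE in_setC; case: (_ \in _) => /=.
  by rewrite sub0r normrN.
by rewrite sub0r normrN opprB addrC addrNK.
Qed.

Lemma approx_setI S1 S2 : approx_set S1 -> approx_set S2 -> approx_set (S1 `&` S2).
Proof.
move=> [m1 h1] [m2 h2]; split; first exact: measurableI.
move=> e e0; have [|g1 Ag1 hg1] := h1 (e / 2); first by rewrite divr_gt0.
have [|g2 Ag2 hg2] := h2 (e / 2); first by rewrite divr_gt0.
have mg1 := mA Ag1; have mg2 := mA Ag2.
have mi S : measurable S -> measurable_fun setT (\1_S : T -> R).
  by move=> ?; exact: measurable_indic.
exists (fun t => g1 t * g2 t); first exact: AM.
rewrite [leRHS]splitr (le_trans _ (lerD hg1 hg2))//.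
have mI : measurable_fun setT (fun t => \1_(S1 `&` S2) t - g1 t * g2 t : R).
  by apply: measurable_funB; [apply: mi; exact: measurableI|exact: measurable_funM].
apply: dist_le => //; try exact: mi; try by move=> t; exact: A01.
- move=> t; have := A01 t Ag1; have := A01 t Ag2.
  rewrite indicI /=; have := indic01 S1 t; have := indic01 S2 t.
  set a := \1_S1 t; set b := \1_S2 t => /andP[b0 b1] /andP[a0 a1] /andP[c0 c1] /andP[e0' e1].
  (* Telescoping: each difference is multiplied by a factor in [0, 1], so the errors add up without
     constants. *)
  have -> : a * b - g1 t * g2 t = (a - g1 t) * b + g1 t * (b - g2 t) by ring.
  rewrite (le_trans (ler_normD _ _))// !normrM lerD//.
    by rewrite ler_piMr// ger0_norm.
  by rewrite ler_piMl// ger0_norm.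
Qed.

(** Closure under intersections comes directly from products of tests, so finite unions follow by De
    Morgan and countable ones by dominated convergence, with no appeal to a pi-lambda argument. *)
Lemma sigma_algebra_approx : sigma_algebra setT approx_set.
Proof.
split.
- by rewrite -setCT; apply: approx_setC; exact: approx_setT.
- by move=> S hS; rewrite setTD; exact: approx_setC.
move=> F hF.
have hU n : approx_set (\big[setU/set0]_(i < n) F i).
  elim: n => [|n ih].
    by rewrite big_ord0 -setCT; apply: approx_setC; exact: approx_setT.
  rewrite big_ord_recr/= -[_ `|` _]setCK setCU.
  by apply: approx_setC; apply: approx_setI; exact: approx_setC.
split; first by apply: bigcupT_measurable => n; case: (hF n).
apply: (@L1_approx_lim (fun n => \1_(\big[setU/set0]_(i < n) F i))).
- by move=> n; apply: measurable_indic; case: (hU n).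
- by apply: measurable_indic; apply: bigcupT_measurable => n; case: (hF n).
- by move=> n t; exact: indic01.
- exact: indic01.
- move=> t; rewrite indicE; have [/set_mem [k _ Fk]|tF] := boolP (t \in _).
    apply: cvg_near_cst; exists k.+1 => // n /= kn.
    rewrite indicE mem_set// -bigcup_mkord.
    by exists k.
  apply: cvg_near_cst; exists 0%N => // n _ /=.
  rewrite indicE memNset// -bigcup_mkord => -[k /= _ Fk].
  by move/negP: tF; apply; rewrite inE; exists k.
- by move=> n; case: (hU n).
Qed.

(** The polynomials of [cvg_threshold] are composed of products and of [f |-> 1 - f], the operations
    under which [A] is assumed stable; this is what singles out the level one half. *)
Lemma approx_set_lt_half f : A f -> approx_set [set t | f t < 2^-1].
Proof.
move=> Af; have mf := mA Af.
have mS : measurable [set t | f t < 2^-1].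
  rewrite (_ : [set _ | _] = f @^-1` `]-oo, 2^-1[).
    by rewrite -[X in measurable X]setTI; apply: mf.
  by apply/seteqP; split => t /=; rewrite in_itv.
have AX g n : A g -> A (fun t => g t ^+ n).
  move=> Ag; elim: n => [|n ih].
    by rewrite (_ : (fun t => _) = cst 1).
  rewrite (_ : (fun t => _) = (fun t => g t * g t ^+ n)).
    exact: AM.
  by apply/funext => t; rewrite exprS.
have Af_ n : A (fun t => (1 - f t ^+ n) ^+ (n * 2 ^ n)).
  exact/AX/AC/AX.
split => //.
apply: (@L1_approx_lim (fun n t => (1 - f t ^+ n) ^+ (n * 2 ^ n))).
- by move=> n; exact: mA.
- exact: measurable_indic.
- by move=> n t; exact: A01 (Af_ n).
- exact: indic01.
- move=> t; rewrite indicE (_ : (t \in _) = (f t < 2^-1)%R).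
    by apply: cvg_threshold; exact: A01.
  by apply/idP/idP; rewrite inE.
- by move=> n; exact: L1_approx_self.
Qed.

End L1_approximation.

(** * Testing between two normal distributions *)

Section normal_integral.
Context {R : realType}.
Notation lambda := (@lebesgue_measure R).
Implicit Types (m s t : R) (G : R -> R).

Lemma ge0_integral_normal_prob m s (f : R -> \bar R) :
  measurable_fun setT f -> (forall x, 0 <= f x)%E ->
  (\int[normal_prob m s]_x f x = \int[lambda]_x (f x * (normal_pdf m s x)%:E))%E.
Proof.
move=> mf f0; have dom := @normal_prob_dominates R m s.
rewrite -(@Radon_Nikodym_SigmaFinite.change_of_variables _ _ _ (normal_prob m s)
  lambda dom f setT)//.
have iRN := Radon_Nikodym_SigmaFinite.f_integrable dom.
have mpdf : measurable_fun setT (fun x => (normal_pdf m s x)%:E).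
  by apply/measurable_EFinP; exact: measurable_normal_pdf.
apply: ae_eq_integral => //.
- by apply: emeasurable_funM => //; exact: (measurable_int lambda).
- exact: emeasurable_funM.
- apply: ae_eqe_mul2l; apply: integral_ae_eq => // E _ mE.
  by rewrite -Radon_Nikodym_SigmaFinite.f_integral.
Qed.

(** Integration by substitution asks for a continuous integrand. This is why the near-optimal test
    in [np_excess_le] is a ramp and not the indicator of a half-line. *)
Lemma normal_prob_affine m s G : 0 < s -> continuous G -> (forall x, 0 <= G x) ->
  (\int[normal_prob m s]_x (G x)%:E =
   \int[normal_prob 0 1]_x (G (m + s * x))%:E)%E.
Proof.
move=> s0 cG G0.
pose F (x : R^o) := m + s * x.
have FE : F = (fun x => (x + m / s) * s).
  by apply/funext => x; rewrite mulrDl divfK ?gt_eqF// addrC mulrC.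
have dF (x : R) : is_derive x 1 F s.
  rewrite (_ : s = 0 + (s *: (1 : R^o) + x *: (0 : R^o))).
    by apply: is_deriveD.
  by rewrite add0r scaler0 addr0 /GRing.scale/= mulr1.
have F'E : F^`()%classic = cst s.
  by apply/funext => x; rewrite derive1E; exact: derive_val.
have cF : continuous F.
  by move=> x; apply: cvgD; [exact: cvg_cst|apply: cvgM; [exact: cvg_cst|exact: cvg_id]].
have mG (H : R -> R) : continuous H -> measurable_fun setT (fun x : R => (H x : R)%:E).
  by move=> cH; apply/measurable_EFinP; exact: continuous_measurable_fun.
rewrite ge0_integral_normal_prob//; last exact: mG.
rewrite ge0_integral_normal_prob; [|  |by move=> x; rewrite lee_fin]; last first.
  suff cGF : continuous (fun x : R => G (m + s * x)) by exact: (mG (fun x => G (m + s * x))).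
  by move=> x; apply: (@continuous_comp _ _ _ F G); [exact: cF|exact: cG].
have cpdf : continuous (normal_pdf m s) by apply: continuous_normal_pdf; rewrite gt_eqF.
under eq_integral do rewrite -EFinM.
rewrite (@increasing_ge0_integration_by_substitutionT R F
  (fun x => G x * normal_pdf m s x)).
- apply: eq_integral => x _; rewrite F'E !fctE/= -EFinM -mulrA; congr (_ * _)%:E.
  rewrite !normal_pdfE ?oner_eq0 ?gt_eqF// /normal_peak /normal_fun /F.
  rewrite addrAC subrr add0r subr0 exprMn expr1n mulrAC; congr (_ * expR _).
    rewrite mul1r -mulrnAr sqrtrM ?sqr_ge0// sqrtr_sqr gtr0_norm//.
    by rewrite invfM mulrAC mulVf ?mul1r// gt_eqF.
  by field; rewrite gt_eqF.
- by move=> x y xy; rewrite /F ltrD2l ltr_pM2l.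
- by rewrite F'E => ?; exact: cvg_cst.
- by rewrite F'E; exact: is_cvg_cst.
- by rewrite F'E; exact: is_cvg_cst.
- by move=> x; case: (dF x).
- by rewrite FE; apply/gt0_cvgMlNy => //; exact: cvg_addrr_Ny.
- by rewrite FE; apply/gt0_cvgMly => //; exact: cvg_addrr.
- by move=> x; apply: cvgM; [exact: cG|exact: cpdf].
- by move=> x; rewrite mulr_ge0// normal_pdf_ge0.
Qed.

Lemma normal_prob_tilt s a (f : R -> R) : s != 0 ->
  measurable_fun setT f -> (forall x, 0 <= f x) ->
  (\int[normal_prob a s]_x (f x)%:E =
   \int[normal_prob 0 s]_x (f x * expR (a / s ^+ 2 * x - a ^+ 2 / (2 * s ^+ 2)))%:E)%E.
Proof.
move=> s0 mf f0.
have mf1 : measurable_fun setT (fun x : R => (f x)%:E) by exact/measurable_EFinP.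
have mf2 : measurable_fun setT
    (fun x => (f x * expR (a / s ^+ 2 * x - a ^+ 2 / (2 * s ^+ 2)))%:E).
  apply/measurable_EFinP; apply: measurable_funM => //.
  by apply: measurableT_comp => //; exact: measurable_funB.
rewrite (ge0_integral_normal_prob _ _ mf1); last by move=> x; rewrite lee_fin.
rewrite (ge0_integral_normal_prob _ _ mf2); last first.
  by move=> x; rewrite lee_fin mulr_ge0// expR_ge0.
apply: eq_integral => x _; rewrite -!EFinM; congr EFin.
rewrite -[RHS]mulrA; congr (_ * _); rewrite !normal_pdfE// mulrCA; congr (_ * _).
rewrite /normal_fun -expRD; congr expR.
by field.
Qed.

(** No Gaussian integral is computed: the total mass 1 of the normal law with mean [t * s ^+ 2] is
    written as a tilt of the centered one, whose exponent is then linear with slope [t]. *)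
Lemma normal_prob_mgf s t : s != 0 ->
  (\int[normal_prob 0 s]_x (expR (t * x))%:E = (expR (t ^+ 2 * s ^+ 2 / 2))%:E)%E.
Proof.
move=> s0.
have : (\int[normal_prob (t * s ^+ 2) s]_x (1 : R)%:E = 1)%E.
  by rewrite integral_cst//= mul1e; exact: probability_setT.
rewrite (@normal_prob_tilt s (t * s ^+ 2) (fun=> 1))//.
under eq_integral.
  move=> x _; rewrite mul1r expRB EFinM.
  rewrite (_ : t * s ^+ 2 / s ^+ 2 = t); last by rewrite mulfK// expf_neq0.
  over.
rewrite ge0_integralZr//; last first.
  by apply/measurable_EFinP; apply: measurableT_comp => //; exact: measurable_funM.
rewrite (_ : (t * s ^+ 2) ^+ 2 / (2 * s ^+ 2) = t ^+ 2 * s ^+ 2 / 2); last by field.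
set I := (\int[_]_x _)%E; set E := expR _.
have E0 : 0 < E by exact: expR_gt0.
(* The identity reads [I] times the inverse of [E] equals 1 in the extended reals, which excludes
   both infinite values of [I]. *)
case: I => [r| |].
- by rewrite -EFinM => -[] h; congr EFin; rewrite -[LHS](divfK (lt0r_neq0 E0)) h mul1r.
- by rewrite gt0_mulye// lte_fin invr_gt0.
- by rewrite gt0_mulNye// lte_fin invr_gt0.
Qed.

(* Neyman-Pearson: the largest value of power minus [k] times level over all tests of
   [N(0, 1)] against [N(r, 1)]. *)
Definition np_excess (k r : R) :=
  \int[normal_prob 0 1]_u Num.max (expR (r * u - r ^+ 2 / 2) - k) 0.

Lemma measurable_tilt (r : R) :
  measurable_fun setT (fun u : R => expR (r * u - r ^+ 2 / 2)).
Proof.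
by apply: measurableT_comp => //; exact: measurable_funB.
Qed.

Lemma integral_tilt (r : R) :
  (\int[normal_prob 0 1]_u (expR (r * u - r ^+ 2 / 2))%:E = 1)%E.
Proof.
under eq_integral do rewrite expRB EFinM.
rewrite ge0_integralZr//; last first.
  by apply/measurable_EFinP; apply: measurableT_comp => //; exact: measurable_funM.
by rewrite normal_prob_mgf ?oner_eq0// expr1n mulr1 -EFinM divff// gt_eqF// expR_gt0.
Qed.

Lemma integrable_tilt (r : R) :
  (normal_prob 0 1).-integrable setT (EFin \o (fun u : R => expR (r * u - r ^+ 2 / 2))).
Proof.
apply/integrableP; split; first by apply/measurable_EFinP; exact: measurable_tilt.
under eq_integral do rewrite /= ger0_norm ?expR_ge0//.
by rewrite integral_tilt ltry.
Qed.

Lemma integrable_excess (k r : R) : (normal_prob 0 1).-integrable setT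
  (EFin \o (fun u : R => Num.max (expR (r * u - r ^+ 2 / 2) - k) 0)).
Proof.
apply: (@integrable_le _ _ _ (normal_prob 0 1) _ (fun u => expR (r * u - r ^+ 2 / 2) + `|k|)).
- apply: measurable_maxr => //; apply: measurable_funB => //.
  exact: measurable_tilt.
- apply: eq_integrable (integrableD measurableT (integrable_tilt r)
    (finite_measure_integrable_cst (normal_prob 0 1) `|k| measurableT)) => //.
- move=> u; have e0 := expR_ge0 (r * u - r ^+ 2 / 2).
  have [h|h] := leP 0 (expR (r * u - r ^+ 2 / 2) - k).
    rewrite ger0_norm// lerD2l.
    by rewrite -normrN ler_norm.
  by rewrite normr0 addr_ge0.
Qed.

(* [h u = min (1, (L_r u - k)^+ / e)] is a near-optimal test which is nondecreasing in the
   observation, hence gains power when the shift grows from [r] to [s]. *)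
Lemma np_excess_le (k r s : R) : 0 <= r -> r <= s ->
  np_excess k r <= np_excess k s.
Proof.
move=> r0 rs; apply/ler_addgt0Pr => e e0.
pose L a (u : R) := expR (a * u - a ^+ 2 / 2).
pose h u := Num.min 1 (e^-1 * Num.max (L r u - k) 0).
have h01 u : 0 <= h u <= 1.
  rewrite ge_min lexx/= le_min ler01/= mulr_ge0 ?invr_ge0 ?(ltW e0)//.
  by rewrite le_max lexx orbT.
have N1 : (normal_prob 0 1 [set: R] < +oo)%E.
  by rewrite (@probability_setT _ _ R (normal_prob 0 1)) ltry.
have h0 u : 0 <= h u by case/andP: (h01 u).
have h1 u : h u <= 1 by case/andP: (h01 u).
have cL a : continuous (L a).
  move=> u; apply: (@continuous_comp _ _ _ (fun u => a * u - a ^+ 2 / 2) expR).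
    apply: cvgB; last exact: cvg_cst.
    by apply: cvgM; [exact: cvg_cst|exact: cvg_id].
  exact: continuous_expR.
have ch : continuous h.
  have cx : continuous (fun u => Num.max (L r u - k) 0 : R^o).
    move=> u; apply: (@continuous_max R R (fun u => L r u - k) (cst 0) u).
      by apply: cvgB; [exact: cL|exact: cvg_cst].
    exact: cvg_cst.
  move=> u; apply: (@continuous_min R R (cst 1) (fun u => e^-1 * Num.max (L r u - k) 0) u).
    exact: cvg_cst.
  by apply: cvgM; [exact: cvg_cst|exact: cx].
have mh : measurable_fun setT h by exact: continuous_measurable_fun.
have mL a : measurable_fun setT (L a) by exact: measurable_tilt.
have h_homo u v : u <= v -> h u <= h v.
  move=> uv; rewrite /h le_min ge_min lexx/= ge_min; apply/orP; right.
  rewrite ler_wpM2l ?invr_ge0 ?(ltW e0)// ge_max !le_max lexx orbT andbT.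
  by rewrite lerD2r ler_expR lerD2r ler_wpM2l.
have ihL a : (normal_prob 0 1).-integrable setT (EFin \o (fun u => h u * L a u)).
  apply: (integrable_le _ (integrable_tilt a)).
    by apply: measurable_funM; [exact: mh|exact: mL].
  by move=> u; rewrite normrM (ger0_norm (h0 u)) (ger0_norm (expR_ge0 _)) ler_piMl ?expR_ge0.
have ih : (normal_prob 0 1).-integrable setT (EFin \o h).
  by apply: (bounded_integrable N1 (K := 1)) => // u; rewrite (ger0_norm (h0 u)).
have shift a : 0 <= a -> \int[normal_prob 0 1]_u (h u * L a u) = \int[normal_prob 0 1]_u h (a + u).
  move=> a0; rewrite /Rintegral; congr fine.
  transitivity (\int[normal_prob a 1]_u (h u)%:E)%E.
    rewrite (@normal_prob_tilt 1 a h (oner_neq0 _) mh h0).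
    by apply: eq_integral => u _; rewrite /L expr1n divr1 mulr1.
  rewrite (normal_prob_affine a ltr01 ch h0).
  by apply: eq_integral => u _; rewrite mul1r.
have iB a : (normal_prob 0 1).-integrable setT (EFin \o (fun u => h u * L a u - k * h u)).
  apply: eq_integrable (integrableB measurableT (ihL a) (integrableZl measurableT k ih)) => //.
have eB a : \int[normal_prob 0 1]_u (h u * L a u - k * h u) =
    \int[normal_prob 0 1]_u (h u * L a u) - k * \int[normal_prob 0 1]_u h u.
  rewrite RintegralB//; last exact: eq_integrable (integrableZl measurableT k ih).
  by rewrite RintegralZl.
apply: (@le_trans _ _ (\int[normal_prob 0 1]_u (h u * L r u - k * h u) + e)).
  rewrite -[e in leRHS](_ : \int[normal_prob 0 1]_u (cst e u) = e); last first.
    by rewrite Rintegral_cst//= (@probability_setT _ _ R (normal_prob 0 1)) mulr1.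
  have ie : (normal_prob 0 1).-integrable setT (EFin \o cst e).
    exact: (finite_measure_integrable_cst (normal_prob 0 1) e measurableT).
  rewrite -RintegralD//; apply: le_Rintegral => //.
  - exact: integrable_excess.
  - exact: eq_integrable (integrableD measurableT (iB r) ie).
  - move=> u _ /=; rewrite [k * _]mulrC -mulrBr /h -/(L r u).
    set x := L r u - k.
    have [x0|x0] := leP 0 x; last by rewrite mulr0 min_r// mul0r add0r ltW.
    have [ex|ex] := leP 1 (e^-1 * x).
      by rewrite mul1r lerDl ltW.
    have xe : x <= e by rewrite mulrC ltr_pdivrMr// mul1r in ex; exact: ltW.
    by rewrite (le_trans xe)// lerDr mulr_ge0// mulr_ge0// invr_ge0 ltW.
rewrite lerD2r eB; apply: (@le_trans _ _ (\int[normal_prob 0 1]_u (h u * L s u - k * h u))).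
  rewrite eB lerD2r !shift ?(le_trans r0 rs)//.
  have ihs a : (normal_prob 0 1).-integrable setT (EFin \o (fun u => h (a + u))).
    apply: (bounded_integrable N1 (K := 1)).
      by apply: measurableT_comp => //; exact: measurable_funD.
    by move=> u; rewrite (ger0_norm (h0 (a + u))).
  by apply: le_Rintegral => // u _; apply: h_homo; rewrite lerD2r.
apply: le_Rintegral => //; first exact: integrable_excess.
move=> u _; rewrite [k * _]mulrC -mulrBr -/(L s u) le_max.
have [x0|x0] := leP 0 (L s u - k); first by rewrite ler_piMl.
by rewrite mulr_ge0_le0 ?orbT// ltW.
Qed.

(** From [(x - 2 * k) ^+ 2 >= 0] the positive part of [x - k] is at most [x ^+ 2 / (4 * k)], and the
    likelihood ratio has second moment [expR (r ^+ 2)]. The decay in [k] settles the level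
    [alpha = 0]. *)
Lemma np_excess_bound (k r : R) : 0 < k -> np_excess k r <= expR (r ^+ 2) / (4 * k).
Proof.
move=> k0.
have e u : expR (r * u - r ^+ 2 / 2) ^+ 2 = expR (r ^+ 2) * expR ((2 * r) * u - (2 * r) ^+ 2 / 2).
  by rewrite -expRM_natl -expRD; congr expR; field.
have it := integrable_tilt (2 * r).
pose c := expR (r ^+ 2) / (4 * k).
have -> : expR (r ^+ 2) / (4 * k) = \int[normal_prob 0 1]_u (c * expR ((2 * r) * u - (2 * r) ^+ 2 / 2)).
  by rewrite RintegralZl// /Rintegral integral_tilt mulr1.
apply: le_Rintegral => //; first exact: integrable_excess.
  exact: eq_integrable (integrableZl measurableT c it).
move=> u _; have -> : c * expR ((2 * r) * u - (2 * r) ^+ 2 / 2) =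
    expR (r * u - r ^+ 2 / 2) ^+ 2 / (4 * k) by rewrite e mulrAC.
set x := expR _; rewrite ler_pdivlMr ?mulr_gt0//.
have := sqr_ge0 (x - 2 * k); have := sqr_ge0 x.
by have [_|_] := leP 0 (x - k); nra.
Qed.

End normal_integral.

(** * Existence of normal quantiles *)

Section normal_quantile.
Context {R : realType}.
Notation N01 := (normal_prob (0 : R) 1).
Notation lambda := (@lebesgue_measure R).
Implicit Types a b c : R.

Let tail c : R := fine (N01 `]c, +oo[).

Let tail_fin c : N01 `]c, +oo[ \is a fin_num.
Proof. exact: fin_num_measure. Qed.

Let integral_expR_sub (t c : R) : t ^+ 2 = 1 ->
  (\int[N01]_u (expR (t * u - c))%:E = (expR (2^-1 - c))%:E)%E.
Proof.
move=> t1.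
under eq_integral do rewrite expRD EFinM.
rewrite ge0_integralZr//; last first.
  by apply/measurable_EFinP; apply: measurableT_comp => //; exact: measurable_funM.
by rewrite normal_prob_mgf ?oner_eq0// t1 expr1n !mul1r -EFinM -expRD.
Qed.

(** A Chernoff bound with fixed parameter; [t ^+ 2 = 1] covers the upper tail ([t = 1]) and the
    lower tail ([t = -1]) together. *)
Let markov_expR (t c : R) (A : set R) : measurable A -> t ^+ 2 = 1 ->
  (forall u, A u -> c <= t * u) -> (N01 A <= (expR (2^-1 - c))%:E)%E.
Proof.
move=> mA t1 Ac; rewrite -(integral_expR_sub c t1).
have -> : N01 A = (\int[N01]_u (\1_A u)%:E)%E by rewrite integral_indic// setIT.
apply: ge0_le_integral => //.
- exact/measurable_EFinP/measurable_indic.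
- apply/measurable_EFinP; apply: measurableT_comp => //.
  by apply: measurable_funB => //; exact: measurable_funM.
- move=> u _; rewrite lee_fin indicE; have [/set_mem Au|_] := boolP (u \in A).
    by rewrite -expR0 ler_expR subr_ge0 Ac.
  exact: expR_ge0.
Qed.

Let tail_lipschitz a b : a <= b ->
  0 <= tail a - tail b <= normal_peak 1 * (b - a).
Proof.
move=> ab.
have e : `]a, +oo[%classic = `]a, b] `|` `]b, +oo[%classic :> set R.
  by rewrite -itv_bndbnd_setU// bnd_simp.
have NE : N01 `]a, +oo[ = (N01 `]a, b] + N01 `]b, +oo[)%E.
  rewrite e measureU//; apply/seteqP; split => // u [] /=.
  by rewrite !in_itv/= andbT => /andP[_ ub] /(le_lt_trans ub); rewrite ltxx.
have fab : N01 `]a, b] \is a fin_num by exact: fin_num_measure.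
have -> : tail a - tail b = fine (N01 `]a, b]).
  by rewrite /tail NE fineD// addrK.
rewrite fine_ge0//= -lee_fin fineK//.
apply: (@le_trans _ _ (\int[lambda]_(x in `]a, b]) (normal_peak 1)%:E)%E).
  apply: ge0_le_integral => //.
  - by move=> x _; rewrite lee_fin normal_pdf_ge0.
  - by apply/measurable_funTS/measurable_EFinP; exact: measurable_normal_pdf.
  - by move=> x _; rewrite lee_fin normal_pdf_ub// oner_neq0.
rewrite integral_cst//= lebesgue_measure_itv/= lte_fin.
have [_|ba] := ltP a b; first by rewrite -EFinD -EFinM.
by rewrite mule0 lee_fin mulr_ge0 ?normal_peak_ge0 ?subr_ge0.
Qed.

Lemma normal_quantile (alpha : R) : 0 < alpha < 1 ->
  exists c, N01 `]c, +oo[ = alpha%:E.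
Proof.
move=> /andP[a0 a1].
(* The two endpoints solve [expR (2^-1 + c0) = 1 - alpha] and [expR (2^-1 - c1) = alpha], so the
   Chernoff bounds place [alpha] between the tails at [c1] and [c0]. *)
pose c0 := ln (1 - alpha) - 2^-1.
pose c1 := 2^-1 - ln alpha.
have c01 : c0 <= c1.
  have := ln_lt0 (andb_true_intro (conj a0 a1)).
  have : ln (1 - alpha) < 0 by apply: ln_lt0; lra.
  rewrite /c0 /c1; lra.
have t1 : tail c1 <= alpha.
  rewrite -lee_fin fineK//.
  rewrite (le_trans (@markov_expR 1 c1 _ _ _ _))// ?expr1n//.
    by move=> u /=; rewrite in_itv/= andbT mul1r => /ltW.
  by rewrite /c1 opprB addrCA subrr addr0 lnK.
have t0 : alpha <= tail c0.
  have : (N01 `]-oo, c0] <= (1 - alpha)%:E)%E.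
    rewrite (le_trans (@markov_expR (-1) (- c0) _ _ _ _))// ?sqrrN ?expr1n//.
      by move=> u /=; rewrite in_itv/= mulN1r lerN2.
    by rewrite /c0 opprK addrC subrK lnK// posrE subr_gt0.
  have -> : `]-oo, c0]%classic = ~` `]c0, +oo[%classic :> set R by rewrite setCitvr.
  have -> : N01 (~` `]c0, +oo[%classic) = (1 - (tail c0)%:E)%E.
    by rewrite (@probability_setC _ _ R N01)// fineK.
  by rewrite -EFinB lee_fin; lra.
have ct : continuous tail.
  move=> x; apply/cvgrPdist_lt => e e0.
  have p0 : 0 < normal_peak (1 : R) by rewrite normal_peak_gt0// oner_neq0.
  near=> y.
  apply: (@le_lt_trans _ _ (normal_peak 1 * `|x - y|)).
    have [xy|/ltW yx] := leP x y.
      have /andP[h1 h2] := tail_lipschitz xy.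
      by rewrite ger0_norm// distrC ger0_norm// subr_ge0.
    have /andP[h1 h2] := tail_lipschitz yx.
    by rewrite distrC !ger0_norm// subr_ge0.
  rewrite mulrC -ltr_pdivlMr//; near: y.
  by apply: (@cvgr_dist_lt _ _ _ _ _ id x); [exact: cvg_id|rewrite divr_gt0].
have [||c _ cE] := @IVT _ tail c0 c1 alpha c01.
- exact: continuous_subspaceT.
- by rewrite ge_min le_max t1 t0 orbT.
by exists c; rewrite -cE fineK.
Unshelve. all: by end_near. Qed.

End normal_quantile.

(** * Lagrangian duality for the normal trade-off function *)

Section gaussian_tradeoff.
Context {R : realType}.
Notation N01 := (normal_prob (0 : R) 1).

(** Since [G_tradeoff] is an infimum, one good test suffices. For [0 < alpha < 1] the half-line of
    level [alpha] has type II error exactly [1 - k * alpha - np_excess k mu] for a suitable [k]. At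
    [alpha = 0] no finite [k] is optimal and [k] is sent to infinity; at [alpha = 1] the test that
    always rejects leaves only [0 <= b] to be used. *)
Lemma G_tradeoff_le (mu alpha b : R) : 0 < mu -> 0 <= alpha <= 1 -> 0 <= b ->
  (forall k, 0 < k -> 1 - k * alpha - np_excess k mu <= b) ->
  (G_tradeoff mu alpha <= b%:E)%E.
Proof.
move=> mu0 /andP[a0 a1] b0 H.
have [ea|alpha0] := eqVneq alpha 0.
  apply: (@le_trans _ _ 1%E).
    apply: ereal_inf_lbound; exists (cst 0) => //.
      split; first exact: measurable_cst.
        by move=> t /=; rewrite lexx ler01.
      by rewrite /= integral_cst// mul0e lee_fin.
    by under eq_integral do rewrite subr0; rewrite integral_cst// mul1e; exact: probability_setT.
  rewrite lee_fin; apply/ler_addgt0Pr => e e0.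
  (* Chosen so that the bound of [np_excess_bound] equals [e]. *)
  pose k := expR (mu ^+ 2) / (4 * e).
  have k0 : 0 < k by rewrite divr_gt0 ?expR_gt0// mulr_gt0.
  have := H k k0; have := np_excess_bound mu k0; rewrite ea.
  have -> : expR (mu ^+ 2) / (4 * k) = e.
    by rewrite /k; field; rewrite gt_eqF//= gt_eqF// expR_gt0.
  lra.
have [ea|alpha1] := eqVneq alpha 1.
  apply: (@le_trans _ _ 0%E); last by rewrite lee_fin.
  apply: ereal_inf_lbound; exists (cst 1) => //.
    split; first exact: measurable_cst.
      by move=> t /=; rewrite lexx ler01.
    by rewrite /= integral_cst// mul1e ea; exact: probability_le1.
  by under eq_integral do rewrite subrr; rewrite integral_cst// mul0e.
have [|c cE] := @normal_quantile R alpha.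
  by rewrite !lt_neqAle eq_sym alpha0 a0 alpha1 a1.
pose L (u : R) := expR (mu * u - mu ^+ 2 / 2).
(* The multiplier is the likelihood ratio at the critical point. As [mu > 0], [L] is increasing, so
   [L] exceeds [k] exactly on the rejection region and [phi] attains [np_excess k mu]. *)
pose k := L c.
have k0 : 0 < k by exact: expR_gt0.
pose phi : R -> R := \1_(`]c, +oo[%classic).
have mphi : measurable_fun setT phi by exact: measurable_indic.
have phi01 u : 0 <= phi u <= 1.
  by rewrite /phi indicE; case: (_ \in _); rewrite lexx ler01.
have iphi : N01.-integrable setT (EFin \o phi) by exact: integrable_indic.
have Iphi' : (\int[N01]_u (phi u)%:E = alpha%:E)%E.
  by rewrite integral_indic// setIT; exact: cE.
have Iphi : \int[N01]_u phi u = alpha by rewrite /Rintegral Iphi'.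
have iL := @integrable_tilt R mu.
have iphiL : N01.-integrable setT (EFin \o (fun u => phi u * L u)).
  apply: (integrable_le _ iL); first by apply: measurable_funM => //; exact: measurable_tilt.
  move=> u; case/andP: (phi01 u) => h0 h1.
  by rewrite normrM !ger0_norm ?expR_ge0// ler_piMl ?expR_ge0.
have exc : np_excess k mu = \int[N01]_u (phi u * L u) - k * alpha.
  rewrite -Iphi -RintegralZl// -RintegralB//; last exact: eq_integrable (integrableZl measurableT k iphi).
  apply: eq_Rintegral => u _; rewrite -/(L u) /phi indicE.
  have [/set_mem|] := boolP (u \in _).
    rewrite /= in_itv/= andbT => cu; rewrite mul1r mulr1 max_l//.
    by rewrite subr_ge0 ler_expR lerD2r ler_pM2l// ltW.
  rewrite notin_setE/= in_itv/= andbT => /negP; rewrite -leNgt => uc.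
  rewrite mul0r mulr0 subrr max_r// subr_le0.
  by rewrite ler_expR lerD2r ler_pM2l.
apply: (@le_trans _ _ (1 - k * alpha - np_excess k mu)%:E); last by rewrite lee_fin H.
apply: ereal_inf_lbound; exists phi.
  split => //.
  by rewrite Iphi'.
rewrite exc opprB addrA subrK.
rewrite (@normal_prob_tilt R 1 mu (fun u => 1 - phi u)) ?oner_neq0//; last 2 first.
- exact: measurable_funB.
- by move=> u; rewrite subr_ge0; case/andP: (phi01 u).
have iB : N01.-integrable setT (EFin \o (fun u => L u - phi u * L u)).
  exact: eq_integrable (integrableB measurableT iL iphiL).
have <- : \int[N01]_u (L u - phi u * L u) = 1 - \int[N01]_u (phi u * L u).
  by rewrite RintegralB//; congr (_ - _); rewrite /Rintegral integral_tilt.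
rewrite fineK; last exact: integrable_fin_num.
apply: eq_integral => u _; congr EFin.
rewrite mulrBl mul1r; by rewrite /L expr1n divr1 mulr1.
Qed.

End gaussian_tradeoff.

(** * Trigonometric polynomials and Borel sets *)

Section inner_product.
Context {R : realType} {H : normedModType R} (ip : H -> H -> R).
Hypothesis Hip : is_inner_product ip.
Implicit Types (x y z : H) (a : R).

Lemma ipC x y : ip x y = ip y x. Proof. by case: Hip. Qed.

Lemma ip_norm x : ip x x = `|x| ^+ 2. Proof. by case: Hip. Qed.

Lemma ipDl x y z : ip (x + y) z = ip x z + ip y z.
Proof. by case: Hip => _ h _; have := h 1 x y z; rewrite scale1r mul1r. Qed.

Lemma ip0l z : ip 0 z = 0.
Proof. by have /eqP := ipDl 0 0 z; rewrite addr0 addrC -subr_eq subrr => /eqP. Qed.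

Lemma ipZl a x z : ip (a *: x) z = a * ip x z.
Proof. by case: Hip => _ h _; have := h a x 0 z; rewrite addr0 ip0l addr0. Qed.

Lemma ipNl x z : ip (- x) z = - ip x z.
Proof. by rewrite -scaleN1r ipZl mulN1r. Qed.

Lemma ipBl x y z : ip (x - y) z = ip x z - ip y z.
Proof. by rewrite ipDl ipNl. Qed.

Lemma ipDr x y z : ip x (y + z) = ip x y + ip x z.
Proof. by rewrite ipC ipDl !(ipC x). Qed.

Lemma ip0r x : ip x 0 = 0. Proof. by rewrite ipC ip0l. Qed.

Lemma ipZr a x y : ip x (a *: y) = a * ip x y.
Proof. by rewrite ipC ipZl (ipC x). Qed.

Lemma ipNr x y : ip x (- y) = - ip x y.
Proof. by rewrite ipC ipNl (ipC x). Qed.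

Lemma cauchy_schwarz x y : `|ip x y| <= `|x| * `|y|.
Proof.
rewrite -ler_sqr ?nnegrE ?mulr_ge0// real_normK ?num_real// exprMn -!ip_norm.
have [y0|y0] := eqVneq y 0; first by rewrite y0 !ip0r expr0n mulr0.
have n0 : 0 < ip y y by rewrite ip_norm exprn_gt0// normr_gt0.
have h0 : 0 <= ip (ip y y *: x - ip x y *: y) (ip y y *: x - ip x y *: y).
  by rewrite ip_norm exprn_ge0.
have e : ip (ip y y *: x - ip x y *: y) (ip y y *: x - ip x y *: y) =
    ip y y * (ip x x * ip y y - ip x y ^+ 2).
  rewrite !(ipDl, ipDr, ipNl, ipNr, ipZl, ipZr) (ipC y x); ring.
by move: h0; rewrite e pmulr_rge0// subr_ge0.
Qed.

Lemma continuous_ip y : continuous (ip ^~ y).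
Proof.
move=> x; apply/cvgrPdist_lt => e e0; near=> z.
rewrite -ipBl (le_lt_trans (cauchy_schwarz _ _))//.
rewrite (@le_lt_trans _ _ (`|x - z| * (`|y| + 1)))//.
  by rewrite ler_wpM2l// lerDl.
rewrite -ltr_pdivlMr ?ltr_wpDl//; near: z.
apply: (@cvgr_dist_lt _ _ _ _ _ id x); first exact: cvg_id.
by rewrite divr_gt0// ltr_wpDl.
Unshelve. all: by end_near. Qed.

End inner_product.

Section borel.
Context {R : realType} {H : normedModType R}.

Lemma measurable_continuous_borel (f : H -> R) :
  continuous f -> measurable_fun setT (f : borel H -> R).
Proof.
move=> /continuousP cf; apply: (measurability _ (RGenOInfty.measurableE R)).
move=> _ [_ [a ->] <-]; rewrite setTI; apply: sub_sigma_algebra.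
by apply: cf; exact: interval_open.
Qed.

Lemma measurable_continuous_borelH (f : H -> H) :
  continuous f -> measurable_fun setT (f : borel H -> borel H).
Proof.
move=> /continuousP cf; apply: (@measurability _ _ (borel H) (borel H) setT f (@open H) erefl).
move=> _ [A oA <-]; rewrite setTI; apply: sub_sigma_algebra.
exact: cf.
Qed.

Lemma separable_dense_seq : separable_space H ->
  exists u : nat -> H, forall z (e : R), 0 < e -> exists n, `|z - u n| < e.
Proof.
move=> [S [/countable_injP[f finj] cS]].
exists (fun n => xget 0 [set x | S x /\ f x = n]) => z e e0.
have /(_ (ball z e)) : closure S z by rewrite cS.
move=> /(_ (nbhsx_ballx z e e0)) [x [Sx zx]].
exists (f x).
have [Sy fy] := @xgetPex _ 0 [set y | S y /\ f y = f x] (ex_intro _ x (conj Sx erefl)).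
rewrite (finj _ x _ _ fy) ?inE//.
by move: zx; rewrite -ball_normE.
Qed.

End borel.

(** * Half-spaces generate the Borel sets of a separable space *)

Section halfspaces.
Context {R : realType} {H : normedModType R} (ip : H -> H -> R).
Hypothesis Hip : is_inner_product ip.
Hypothesis Hsep : separable_space H.

Definition halfspaces : set (set H) :=
  [set A | exists y c, A = [set z | c < ip z y]].

Let T := g_sigma_algebraType halfspaces.

(** A closed ball is cut out by the inequalities [ip (z - a) x <= r * |x|]: Cauchy-Schwarz in one
    direction, [x = z - a] in the other. By density the vectors [u n] are enough, which makes the
    intersection countable. *)
Let measurable_cball (a : H) (r : R) : 0 <= r ->
  measurable ([set z | `|z - a| <= r] : set T).
Proof.
move=> r0; have [u uP] := separable_dense_seq Hsep.
have -> : [set z | `|z - a| <= r] =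
    \bigcap_n ~` [set z | r * `|u n| + ip a (u n) < ip z (u n)].
  apply/seteqP; split => z /=.
    move=> za n _ /=; apply/negP; rewrite -leNgt -lerBlDr -(ipBl Hip).
    rewrite (le_trans (ler_norm _))// (le_trans (cauchy_schwarz Hip _ _))//.
    by rewrite ler_wpM2r.
  move=> h; have key x : ip (z - a) x <= r * `|x|.
    apply/ler_addgt0Pr => e e0.
    (* Replacing [x] by [u n] costs at most [r + |z - a|] times their distance; the added 1 keeps
       the divisor positive. *)
    have d0 : 0 < r + `|z - a| + 1 by rewrite ltr_wpDl// addr_ge0.
    have [n un] := uP x (e / (r + `|z - a| + 1)) (divr_gt0 e0 d0).
    have := h n I; rewrite /= => /negP; rewrite -leNgt -lerBlDr -(ipBl Hip) => hn.
    rewrite -[x in leLHS](subrK (u n)) (ipDr Hip).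
    have h1 : ip (z - a) (x - u n) <= `|z - a| * `|x - u n|.
      exact: le_trans (ler_norm _) (cauchy_schwarz Hip _ _).
    have h2 : r * `|u n| <= r * `|x| + r * `|x - u n|.
      rewrite -mulrDr ler_wpM2l// -[u n in leLHS](subrK x) (le_trans (ler_normD _ _))//.
      by rewrite addrC distrC.
    have h3 : (r + `|z - a|) * `|x - u n| <= e.
      rewrite (@le_trans _ _ ((r + `|z - a| + 1) * `|x - u n|))//.
        by rewrite ler_wpM2r// lerDl.
      by rewrite mulrC -ler_pdivlMr// ltW.
    by lra.
  have := key (z - a); rewrite (ip_norm Hip) expr2.
  have [->|za0] := eqVneq (`|z - a|) 0; first by [].
  by rewrite ler_pM2r// lt_neqAle eq_sym za0 normr_ge0.
apply: bigcapT_measurable => n; apply: measurableC.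
by apply: sub_sigma_algebra; exists (u n), (r * `|u n| + ip a (u n)).
Qed.

Lemma open_sub_halfspaces : @open H `<=` <<s halfspaces >>.
Proof.
move=> U oU; have [u uP] := separable_dense_seq Hsep.
pose B k n : set H := [set z | `|z - u k| <= n.+1%:R^-1].
have -> : U = \bigcup_k \bigcup_(n in [set n | B k n `<=` U]) B k n.
  apply/seteqP; split => z; last by case=> k _ [n /= BU /BU].
  move=> Uz; have := open_nbhs_nbhs (conj oU Uz).
  rewrite -nbhs_ballE => -[e /= e0 zeU].
  have [n ne] : exists n, n.+1%:R^-1 < e / 2 :> R.
    have /cvgrPdist_lt/(_ (e / 2)) := @cvg_harmonic R.
    rewrite divr_gt0// => /(_ isT)[n _ /(_ n (leqnn n))].
    by rewrite sub0r normrN /= ger0_norm// => ?; exists n.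
  have [k zk] := uP z n.+1%:R^-1 (ltac:(by rewrite invr_gt0)).
  exists k => //; exists n; last exact: ltW.
  move=> x /= xk; apply: zeU; rewrite -ball_normE /ball_/=.
  rewrite -(subrK (u k) z) -addrA (le_lt_trans (ler_normD _ _))//.
  by rewrite [ltRHS]splitr ltrD ?(lt_trans zk)// distrC (le_lt_trans xk).
apply: (@bigcup_measurable _ T) => k _.
apply: (@bigcup_measurable _ T) => n _.
exact: measurable_cball.
Qed.

End halfspaces.

Section trigonometric_polynomials.
Context {R : realType} {H : normedModType R} (ip : H -> H -> R).
Hypothesis Hip : is_inner_product ip.

(** The free phase [th] makes sines and constants instances of one generator. Products are derived
    by the product-to-sum formula and not a constructor, so that an integral estimate has to be
    checked on a single cosine only and extends by linearity. *)
Inductive trig_poly : (H -> R) -> Prop :=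
| trig_cos y th : trig_poly (fun z => cos (ip z y + th))
| trig_add f g : trig_poly f -> trig_poly g -> trig_poly (fun z => f z + g z)
| trig_scale a f : trig_poly f -> trig_poly (fun z => a * f z).

Lemma trig_cst a : trig_poly (cst a).
Proof.
rewrite (_ : cst a = fun z => a * cos (ip z 0 + 0)); last first.
  by apply/funext => z /=; rewrite (ip0r Hip) addr0 cos0 mulr1.
by apply: trig_scale; exact: trig_cos.
Qed.

Lemma trig_mul f g : trig_poly f -> trig_poly g -> trig_poly (fun z => f z * g z).
Proof.
move=> tf; elim: tf g => [y th|f1 f2 _ ih1 _ ih2|a f1 _ ih1] g tg.
- elim: tg => [y' th'|g1 g2 _ ih1 _ ih2|a g1 _ ih1].
  + rewrite (_ : (fun z => _) = fun z => 2^-1 * (cos (ip z (y + y') + (th + th'))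
        + cos (ip z (y - y') + (th - th')))).
      by apply/trig_scale/trig_add; exact: trig_cos.
    apply/funext => z; rewrite (ipDr Hip) (ipDr Hip) (ipNr Hip).
    have -> : ip z y + ip z y' + (th + th') = (ip z y + th) + (ip z y' + th') by ring.
    have -> : ip z y - ip z y' + (th - th') = (ip z y + th) - (ip z y' + th') by ring.
    by rewrite (cosD (ip z y + th)) (cosB (ip z y + th)); field.
  + rewrite (_ : (fun z => _) = fun z => cos (ip z y + th) * g1 z + cos (ip z y + th) * g2 z).
      exact: trig_add.
    by apply/funext => z; rewrite mulrDr.
  + rewrite (_ : (fun z => _) = fun z => a * (cos (ip z y + th) * g1 z)).
      exact: trig_scale.
    by apply/funext => z; rewrite mulrCA.
- rewrite (_ : (fun z => _) = fun z => f1 z * g z + f2 z * g z).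
    by apply: trig_add; [exact: ih1|exact: ih2].
  by apply/funext => z; rewrite mulrDl.
- rewrite (_ : (fun z => _) = fun z => a * (f1 z * g z)).
    by apply: trig_scale; exact: ih1.
  by apply/funext => z; rewrite mulrA.
Qed.

Lemma continuous_trig f : trig_poly f -> continuous f.
Proof.
elim=> {f} [y th|f g _ cf _ cg|a f _ cf] z.
- apply: (@continuous_comp _ _ _ (fun z => ip z y + th) cos).
    by apply: cvgD; [exact: continuous_ip|exact: cvg_cst].
  exact: continuous_cos.
- by apply: cvgD; [exact: cf|exact: cg].
- by apply: cvgM; [exact: cvg_cst|exact: cf].
Qed.

Definition trig_test : set (H -> R) :=
  [set f | trig_poly f /\ forall z, 0 <= f z <= 1].

Lemma trig_test_cst1 : trig_test (cst 1).
Proof. by split; [exact: trig_cst|move=> z /=; rewrite ler01 lexx]. Qed.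

Lemma trig_test_onem f : trig_test f -> trig_test (fun z => 1 - f z).
Proof.
move=> [tf f01]; split; last by move=> z; have := f01 z; lra.
rewrite (_ : (fun z => _) = fun z => cst 1 z + (-1) * f z).
  by apply: trig_add; [exact: trig_cst|exact: trig_scale].
by apply/funext => z /=; rewrite mulN1r.
Qed.

Lemma trig_test_mul f g : trig_test f -> trig_test g -> trig_test (fun z => f z * g z).
Proof.
move=> [tf f01] [tg g01]; split; first exact: trig_mul.
move=> z; case/andP: (f01 z) => ? ?; case/andP: (g01 z) => ? ?.
by rewrite mulr_ge0// mulr_ile1.
Qed.

Lemma measurable_trig_test f : trig_test f -> measurable_fun setT (f : borel H -> R).
Proof. by case=> tf _; apply: measurable_continuous_borel; exact: continuous_trig. Qed.

(** A test with values in [0, 1] that is below one half where the sine is positive. The divisor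
    [n.+1] stretches the period, so that any given point ends up in the half-period adjacent to the
    hyperplane [ip z y = c]. *)
Let wave y (c : R) n (z : H) := (1 - sin ((ip z y - c) / n.+1%:R)) / 2.

Let trig_test_wave y c n : trig_test (wave y c n).
Proof.
split; last first.
  by move=> z; have := sin_le1 ((ip z y - c) / n.+1%:R); have := sin_geN1 ((ip z y - c) / n.+1%:R);
     rewrite /wave; lra.
rewrite (_ : wave y c n = fun z => cst (2^-1) z +
    2^-1 * cos (ip z (n.+1%:R^-1 *: y) + (- c / n.+1%:R + pi / 2))).
  by apply: trig_add; [exact: trig_cst|apply: trig_scale; exact: trig_cos].
apply/funext => z; rewrite (ipZr Hip) addrA.
have -> : n.+1%:R^-1 * ip z y + - c / n.+1%:R = (ip z y - c) / n.+1%:R by ring.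
by rewrite cosDpihalf /wave /=; field.
Qed.

Let wave_lt_half y c n z :
  (wave y c n z < 2^-1) = (0 < sin ((ip z y - c) / n.+1%:R)).
Proof. by rewrite /wave; apply/idP/idP; lra. Qed.

Let cvg_div_nat (t e : R) : 0 < e -> \forall n \near \oo, `|t / n.+1%:R| < e.
Proof.
move=> e0.
have : t / n.+1%:R @[n --> \oo] --> t * 0.
  by apply: cvgM; [exact: cvg_cst|exact: cvg_harmonic].
rewrite mulr0 => /cvgrPdist_lt/(_ e e0); apply: filterS => n.
by rewrite sub0r normrN.
Qed.

(* Eventually in [n], [sin ((ip z y - c) / n)] has the sign of [ip z y - c]. *)
Let halfspace_wave y c : [set z | c < ip z y] =
  \bigcup_N ~` \bigcup_n ~` [set z | wave y c (n + N) z < 2^-1].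
Proof.
apply/seteqP; split => z /=.
  move=> cz; have [N _ hN] := cvg_div_nat (ip z y - c) (@pi_gt0 R).
  exists N => // -[n _ /=]; apply.
  rewrite wave_lt_half sin_gt0_pi//.
  have := hN (n + N)%N (leq_addl _ _); rewrite /= => h.
  rewrite (le_lt_trans (ler_norm _) h) andbT divr_gt0// subr_gt0//.
move=> [N _ h]; rewrite ltNge; apply/negP => zc; apply: h.
have [M _ hM] := cvg_div_nat (ip z y - c) (@pi_gt0 R).
exists M => //=; rewrite wave_lt_half; apply/negP; rewrite -leNgt.
have := hM (M + N)%N (leq_addr _ _); rewrite /= -normrN => hn.
rewrite -oppr_ge0 -sinN sin_ge0_pi//.
rewrite (le_trans (ler_norm _) (ltW hn)) andbT -mulNr divr_ge0// opprB subr_ge0//.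
Qed.

Hypothesis Hsep : separable_space H.

Lemma approx_set_borel (m : {measure set (borel H) -> \bar R}) :
  (m setT < +oo)%E ->
  forall S : set (borel H), measurable S -> approx_set m trig_test S.
Proof.
move=> mfin; have sA : sigma_algebra setT (approx_set m trig_test).
  apply: sigma_algebra_approx => //.
  - exact: measurable_trig_test.
  - by move=> f t [_].
  - exact: trig_test_cst1.
  - exact: trig_test_onem.
  - exact: trig_test_mul.
case: (sA) => s0 sC sU.
have sC' A : approx_set m trig_test A -> approx_set m trig_test (~` A).
  by rewrite -setTD; exact: sC.
have sub : <<s halfspaces ip >> `<=` approx_set m trig_test.
  apply: smallest_sub => // _ [y [c ->]].
  (* The half-space is a lower limit of sets [wave < 1/2], written with complements and countable
     unions, the two operations at hand. *)
  rewrite halfspace_wave; apply/sU => N; apply/sC'/sU => n; apply/sC'.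
  apply: approx_set_lt_half => //.
  - exact: measurable_trig_test.
  - by move=> f t [_].
  - exact: trig_test_cst1.
  - exact: trig_test_onem.
  - exact: trig_test_mul.
move=> S mS; apply: sub; move: S mS; apply: smallest_sub.
  exact: smallest_sigma_algebra.
exact: open_sub_halfspaces.
Qed.

End trigonometric_polynomials.

(** * Shifts of a Gaussian vector *)

Lemma cos_lipschitz (R : realType) (x y : R) : `|cos x - cos y| <= `|x - y|.
Proof.
wlog xy : x y / x <= y.
  by move=> h; have [/h//|/ltW/h] := leP x y; rewrite distrC [leRHS]distrC.
have cc : {within `[x, y], continuous (@cos R)}.
  by apply: continuous_subspaceT; exact: continuous_cos.
have [c _ e] := MVT_segment xy (fun t _ => is_derive_cos t) cc.
by rewrite distrC e normrM normrN [leRHS]distrC ler_piMl// sin_max.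
Qed.

Section gaussian_vector.
Context (R : realType) (H : normedModType R) (ip : H -> H -> R).
Hypothesis Hip : is_inner_product ip.
Context d (Omega : measurableType d) (P : probability Omega R).
Variables (Z : Omega -> H) (C : H -> H).
Hypothesis HZ : centered_gaussian ip P Z C.
Notation N01 := (normal_prob (0 : R) 1).
Implicit Types (x y z : H).

Local Notation c x y := (ip (C x) y).
Local Notation v x := (ip (C x) x).

Let mZ : measurable_fun setT (Z : Omega -> borel H).
Proof. by case: HZ. Qed.

Lemma measurable_continuous_comp (f : H -> R) : continuous f ->
  measurable_fun setT (fun w => f (Z w)).
Proof.
move=> cf; apply: (measurableT_comp _ mZ).
exact: measurable_continuous_borel.
Qed.

Lemma measurable_proj x : measurable_fun setT (fun w => ip (Z w) x).
Proof. by apply: (@measurable_continuous_comp (ip ^~ x)); exact: continuous_ip. Qed.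

Lemma covE x y : (\int[P]_w (ip (Z w) x * ip (Z w) y)%:E = (c x y)%:E)%E.
Proof. by case: HZ. Qed.

(** The map [C] is not given as linear. Symmetry is read off the covariance integral, and linearity
    on the left then follows from that of [ip] on the right. *)
Lemma covC x y : c x y = c y x.
Proof.
apply: EFin_inj; rewrite -!covE.
by apply: eq_integral => w _; rewrite mulrC.
Qed.

Lemma varD x y : v (x + y) = v x + 2 * c x y + v y.
Proof.
by rewrite (ipDr Hip) (covC (x + y) x) (covC (x + y) y) !(ipDr Hip) (covC y x); ring.
Qed.

Lemma varZ a x : v (a *: x) = a ^+ 2 * v x.
Proof. by rewrite (ipZr Hip) covC (ipZr Hip) expr2 mulrA. Qed.

Lemma var_ge0 x : 0 <= v x.
Proof.
rewrite -lee_fin -covE; apply: integral_ge0 => w _.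
by rewrite lee_fin -expr2 sqr_ge0.
Qed.

(** Scaling a standard normal by the standard deviation covers the degenerate case too: for variance
    0 the right-hand side is [f 0], the integral against the Dirac mass. *)
Lemma gaussian_proj_integral x (f : R -> R) : continuous f -> (forall u, 0 <= f u) ->
  (\int[P]_w (f (ip (Z w) x))%:E = \int[N01]_u (f (Num.sqrt (v x) * u))%:E)%E.
Proof.
move=> cf f0.
pose X : Omega -> measurableTypeR R := fun w => ip (Z w) x.
have mX : measurable_fun setT X by exact: measurable_proj.
pose nu := measure_function_pushforward__canonical__measure_function_Measure P mX.
have mf : measurable_fun setT (fun u : measurableTypeR R => (f u)%:E).
  by apply/measurable_EFinP; exact: continuous_measurable_fun.
transitivity (\int[nu]_u (f u)%:E)%E.
  by rewrite (ge0_integral_pushforward mX P measurableT mf)// => u _; rewrite lee_fin.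
case: HZ => _ law _; rewrite /centered_normal in law.
have [v0|v0] := eqVneq (v x) 0.
  rewrite (@eq_measure_integral _ _ R setT (@dirac _ (measurableTypeR R) 0 R) nu); last first.
    by move=> A mA _; have := law x A mA; rewrite v0 eqxx.
  rewrite integral_dirac// diracT mul1e v0 sqrtr0.
  under eq_integral do rewrite mul0r.
  by rewrite integral_cst//= (@probability_setT _ _ R N01) mule1.
have vp : 0 < v x by rewrite lt_neqAle eq_sym v0 var_ge0.
rewrite (@eq_measure_integral _ _ R setT (normal_prob 0 (Num.sqrt (v x))) nu); last first.
  by move=> A mA _; have := law x A mA; rewrite (negbTE v0).
have s0 : 0 < Num.sqrt (v x) by rewrite sqrtr_gt0.
rewrite (normal_prob_affine 0 s0 cf f0).
by apply: eq_integral => u _; rewrite add0r.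
Qed.

Lemma gaussian_mgf x :
  (\int[P]_w (expR (ip (Z w) x))%:E = (expR (v x / 2))%:E)%E.
Proof.
rewrite (gaussian_proj_integral x (@continuous_expR R) (@expR_ge0 R)).
by rewrite normal_prob_mgf ?oner_neq0// expr1n mulr1 sqr_sqrtr ?var_ge0.
Qed.

Lemma gaussian_mgf_integrable x (a : R) :
  P.-integrable setT (EFin \o (fun w => expR (ip (Z w) x + a))).
Proof.
have ix : P.-integrable setT (EFin \o (fun w => expR (ip (Z w) x))).
  apply/integrableP; split.
    by apply/measurable_EFinP; apply: measurableT_comp => //; exact: measurable_proj.
  under eq_integral do rewrite /= ger0_norm ?expR_ge0//.
  by rewrite gaussian_mgf ltry.
apply: eq_integrable (integrableZl measurableT (expR a) ix) => // w _.
by rewrite /= -EFinM -expRD addrC.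
Qed.

Lemma gaussian_mgf_Rintegral x (a : R) :
  \int[P]_w expR (ip (Z w) x + a) = expR (v x / 2 + a).
Proof.
under eq_Rintegral do rewrite addrC expRD.
rewrite RintegralZl//; last first.
  have := gaussian_mgf_integrable x 0.
  by apply: eq_integrable => // w _; rewrite /= addr0.
by rewrite /Rintegral gaussian_mgf /= -expRD addrC.
Qed.

(** The Cameron-Martin density of the shift by [s *: C x]. The factor [s] is kept apart because [x]
    will range over the unit ball of the covariance form while [s] is the norm of the shift to be
    approximated. *)
Definition cm_density (s : R) x (w : Omega) : R := expR (s * ip (Z w) x - s ^+ 2 * v x / 2).

Lemma cm_densityE s x w : cm_density s x w = expR (ip (Z w) (s *: x) - s ^+ 2 * v x / 2).
Proof. by rewrite /cm_density (ipZr Hip). Qed.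

Lemma measurable_cm_density s x : measurable_fun setT (cm_density s x).
Proof.
apply: measurableT_comp => //; apply: measurable_funB => //.
by apply: measurable_funM => //; exact: measurable_proj.
Qed.

Lemma integrable_cm_density s x : P.-integrable setT (EFin \o cm_density s x).
Proof.
apply: eq_integrable (gaussian_mgf_integrable (s *: x) (- (s ^+ 2 * v x / 2))) => // w _.
by rewrite /= cm_densityE.
Qed.

(* Both sides are [\int w * cos (W + th)] for pairs [(w, W)] with the same exponential moments
   [b |-> \int w * exp (b W)]; no characteristic function is ever computed. *)
Lemma cameron_martin_cos s x y th :
  \int[P]_w (cm_density s x w * cos (ip (Z w) y + th)) =
  \int[P]_w cos (ip (Z w) y + s * c x y + th).
Proof.
transitivity (\int[P]_w (cst 1 w * cos (ip (Z w) y + s * c x y + th))); last first.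
  by apply: eq_Rintegral => w _; rewrite /= mul1r.
have m1 b w : cm_density s x w * expR (b * ip (Z w) y) =
    expR (ip (Z w) (s *: x + b *: y) + - (s ^+ 2 * v x / 2)).
  by rewrite cm_densityE -expRD; congr expR; rewrite (ipDr Hip) !(ipZr Hip); ring.
have m2 b w : cst 1 w * expR (b * (ip (Z w) y + s * c x y)) =
    expR (ip (Z w) (b *: y) + b * (s * c x y)).
  by rewrite /= mul1r; congr expR; rewrite (ipZr Hip); ring.
apply: (@mgf_eq_cos _ _ _ P (cm_density s x) (fun w => ip (Z w) y) (cst 1)
  (fun w => ip (Z w) y + s * c x y)).
- exact: measurable_cm_density.
- exact: measurable_proj.
- exact: measurable_cst.
- by apply: measurable_funD => //; exact: measurable_proj.
- by move=> w; exact: expR_ge0.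
- by move=> w; exact: ler01.
- move=> b; apply: eq_integrable (gaussian_mgf_integrable (s *: x + b *: y) (- (s ^+ 2 * v x / 2))) => // w _.
  by rewrite /= m1.
- move=> b; apply: eq_integrable (gaussian_mgf_integrable (b *: y) (b * (s * c x y))) => // w _.
  by rewrite /= -m2.
- move=> b; under eq_Rintegral do rewrite m1.
  under [RHS]eq_Rintegral do rewrite m2.
  rewrite !gaussian_mgf_Rintegral; congr expR.
  by rewrite varD !varZ (ipZr Hip) covC (ipZr Hip) (covC y x); field.
Qed.

(* First-order optimality: if [x] almost maximizes [ip delta] on the unit ball of [v], then
   [s * c x] almost equals [ip delta]; this replaces the Riesz representation of [delta]. *)
Lemma almost_riesz (delta : H) (s : R) : 0 <= s ->
  (forall x, v x <= 1 -> ip delta x <= s) ->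
  (forall e, 0 < e -> exists2 x, v x <= 1 & s - e < ip delta x) ->
  forall t, 0 < t -> exists2 x, v x <= 1 &
    forall y, `|ip delta y - s * c x y| <= t * (1 + s * v y / 2).
Proof.
move=> s0 le_s near_s t t0.
(* Scaling by [2 / (1 + v z)] brings [z] into the unit ball, as [4 * v z <= (1 + v z) ^+ 2]. This
   gives a bound quadratic in [z], without square roots or a separate case [v z = 0]. *)
have hz z : ip delta z <= s * (1 + v z) / 2.
  have p : 0 < 1 + v z by rewrite ltr_pwDl// var_ge0.
  have : v ((2 / (1 + v z)) *: z) <= 1.
    rewrite varZ exprMn exprVn mulrAC ler_pdivrMr ?exprn_gt0// mul1r.
    by have := sqr_ge0 (1 - v z); lra.
  by move/le_s; rewrite (ipZr Hip) mulrAC ler_pdivrMr// ; lra.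
(* The bound [hz] is applied at [x + t *: y'] and divided by [t], so a defect [t ^+ 2] in the
   maximization leaves an error [t]. *)
have [x vx xs] := near_s (t ^+ 2) (exprn_gt0 2 t0).
exists x => // y.
have key y' : ip delta y' - s * c x y' <= t * (1 + s * v y' / 2).
  have := hz (x + t *: y'); rewrite (ipDr Hip) (ipZr Hip) varD varZ (ipZr Hip) => h.
  have h2 : s * v x <= s by rewrite ler_piMr.
  rewrite -(ler_pM2l t0); nra.
rewrite ler_norml key andbT lerNl opprB.
have vN : v (- y) = v y by rewrite -scaleN1r varZ sqrrN expr1n mul1r.
have cN : c x (- y) = - c x y by rewrite -scaleN1r (ipZr Hip) mulN1r.
have := key (- y); rewrite (ipNr Hip) vN cN.
lra.
Qed.

(** The constant [K] is fixed before [t] and [x], so the precision [t] can be chosen once [f] is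
    known. For one cosine the error is a difference of phases, as [cos] is 1-Lipschitz.
    Integrability is part of the conclusion because the induction on [f] splits integrals. *)
Lemma trig_test_shift (delta : H) (s : R) (f : H -> R) : trig_poly ip f ->
  P.-integrable setT (EFin \o (fun w => f (Z w + delta))) /\
  exists2 K, 0 <= K & forall t x, 0 < t ->
    (forall y, `|ip delta y - s * c x y| <= t * (1 + s * v y / 2)) ->
    P.-integrable setT (EFin \o (fun w => cm_density s x w * f (Z w))) /\
    `|\int[P]_w f (Z w + delta) - \int[P]_w (cm_density s x w * f (Z w))| <= K * t.
Proof.
have mshift g : trig_poly ip g -> measurable_fun setT (fun w => g (Z w + delta)).
  move=> tg; apply: (@measurable_continuous_comp (fun z => g (z + delta))) => z.
  apply: (@continuous_comp _ _ _ (fun z => z + delta) g).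
    by apply: cvgD; [exact: cvg_id|exact: cvg_cst].
  exact: (continuous_trig Hip tg).
have Pfin : (P setT < +oo)%E by rewrite probability_setT ltry.
elim=> {f} [y th|f g tf [if1 [K1 K10 h1]] tg [ig1 [K2 K20 h2]]|a f tf [if1 [K K0 h]]].
- have ic (g : Omega -> R) : measurable_fun setT g ->
      P.-integrable setT (EFin \o (fun w => cos (g w))).
    move=> mg; apply: (bounded_integrable Pfin (K := 1)).
      apply: measurableT_comp => //.
      by apply: continuous_measurable_fun; exact: continuous_cos.
    by move=> w; rewrite ler_norml cos_geN1 cos_le1.
  have mS : measurable_fun setT (fun w => ip (Z w + delta) y + th).
    apply: measurable_funD => //.
    apply: (@measurable_continuous_comp (fun z => ip (z + delta) y)) => z.
    apply: (@continuous_comp _ _ _ (fun z => z + delta) (ip ^~ y)).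
      by apply: cvgD; [exact: cvg_id|exact: cvg_cst].
    exact: continuous_ip.
  split; first exact: ic.
  exists (`|1 + s * v y / 2|) => // t x t0 /(_ y) xy; split.
    apply: (integrable_le _ (integrable_cm_density s x)).
      apply: measurable_funM; first exact: measurable_cm_density.
      apply: (@measurable_continuous_comp (fun z => cos (ip z y + th))).
      exact: (continuous_trig Hip (trig_cos _ _ _)).
    move=> w; rewrite normrM ger0_norm ?expR_ge0// ler_piMr ?expR_ge0//.
    by rewrite ler_norml cos_geN1 cos_le1.
  rewrite cameron_martin_cos -RintegralB//; last 2 first.
  + exact: ic.
  + apply: ic; apply: measurable_funD => //; apply: measurable_funD => //.
    exact: measurable_proj.
  have mI : P.-integrable setT (EFin \o (fun w => cos (ip (Z w + delta) y + th) -
      cos (ip (Z w) y + s * c x y + th))).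
    apply: eq_integrable (integrableB measurableT (ic _ mS) (ic (fun w => ip (Z w) y + s * c x y + th) _)) => //.
    apply: measurable_funD => //; apply: measurable_funD => //.
    exact: measurable_proj.
  rewrite (le_trans (le_normr_Rintegral _ _))//.
  rewrite (@le_trans _ _ (\int[P]_w (cst (t * (1 + s * v y / 2)) w : R)))//.
    apply: le_Rintegral => //.
    + exact: integrable_norm.
    + exact: (finite_measure_integrable_cst P _ measurableT).
    + move=> w _ /=; rewrite (le_trans (cos_lipschitz _ _))// (le_trans _ xy)//.
      rewrite (ipDl Hip) le_eqVlt; apply/orP; left; apply/eqP; congr `|_|; ring.
  rewrite Rintegral_cst//= (@probability_setT _ _ R P) mulr1 [leLHS]mulrC.
  by apply: ler_wpM2r; [exact: ltW|exact: ler_norm].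
- split.
    exact: eq_integrable (integrableD measurableT if1 ig1).
  exists (K1 + K2); first exact: addr_ge0.
  move=> t x t0 xy; have [i1 l1] := h1 t x t0 xy; have [i2 l2] := h2 t x t0 xy.
  have e w : cm_density s x w * (f (Z w) + g (Z w)) =
    cm_density s x w * f (Z w) + cm_density s x w * g (Z w) by rewrite mulrDr.
  split.
    by apply: eq_integrable (integrableD measurableT i1 i2) => // w _; rewrite /= e EFinD.
  under [X in _ - X]eq_Rintegral do rewrite e.
  rewrite !RintegralD// opprD addrACA mulrDl (le_trans (ler_normD _ _))//.
  exact: lerD.
- split.
    exact: eq_integrable (integrableZl measurableT a if1).
  exists (`|a| * K); first exact: mulr_ge0.
  move=> t x t0 xy; have [i1 l1] := h t x t0 xy.
  have e w : cm_density s x w * (a * f (Z w)) = a * (cm_density s x w * f (Z w)).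
    by rewrite mulrCA.
  split.
    by apply: eq_integrable (integrableZl measurableT a i1) => // w _; rewrite /= e.
  under [X in _ - X]eq_Rintegral do rewrite e.
  by rewrite !RintegralZl// -mulrBr normrM -mulrA ler_wpM2l.
Qed.

Lemma measurable_shift (delta : H) :
  measurable_fun setT ((fun w => Z w + delta) : Omega -> borel H).
Proof.
apply: (measurableT_comp (f := fun z : borel H => (z + delta : H) : borel H) _ mZ).
apply: measurable_continuous_borelH => z.
by apply: cvgD; [exact: cvg_id|exact: cvg_cst].
Qed.

Let Pfin : (P setT < +oo)%E. Proof. by rewrite probability_setT ltry. Qed.

Let integrable01 (f : Omega -> R) : measurable_fun setT f ->
  (forall w, 0 <= f w <= 1) -> P.-integrable setT (EFin \o f).
Proof.
move=> mf f01; apply: (bounded_integrable Pfin (K := 1)) => // w.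
by case/andP: (f01 w) => ? ?; rewrite ger0_norm.
Qed.

(** The density depends on a centered normal variable of variance [v x], so its expected excess is
    the one-dimensional optimum with shift [s * Num.sqrt (v x)], which is at most [mu]. *)
Let excess_cm_density (k s mu : R) x : 0 <= s -> s <= mu -> v x <= 1 ->
  P.-integrable setT (EFin \o (fun w => Num.max (cm_density s x w - k) 0)) /\
  \int[P]_w Num.max (cm_density s x w - k) 0 <= np_excess k mu.
Proof.
move=> s0 smu vx; split.
  have iL := integrable_cm_density s x.
  apply: (@integrable_le _ _ _ P _ (fun w => cm_density s x w + `|k|)).
  - apply: measurable_maxr => //; apply: measurable_funB => //.
    exact: measurable_cm_density.
  - exact: eq_integrable (integrableD measurableT iL
      (finite_measure_integrable_cst P `|k| measurableT)).
  - move=> w; have e0 : 0 <= cm_density s x w by exact: expR_ge0.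
    have [h|h] := leP 0 (cm_density s x w - k).
      by rewrite ger0_norm// lerD2l -normrN ler_norm.
    by rewrite normr0 addr_ge0.
apply: (@le_trans _ _ (np_excess k (s * Num.sqrt (v x)))); last first.
  apply: np_excess_le; first by rewrite mulr_ge0// sqrtr_ge0.
  rewrite (le_trans _ smu)// ler_piMr// -sqrtr1 ler_wsqrtr//.
pose f (u : R) : R := Num.max (expR (s * u - s ^+ 2 * v x / 2) - k) 0.
have cf : continuous f.
  move=> u; apply: (@continuous_max R R (fun u => expR (s * u - s ^+ 2 * v x / 2) - k) (cst 0) u).
    apply: cvgB; last exact: cvg_cst.
    apply: (@continuous_comp _ _ _ (fun u => s * u - s ^+ 2 * v x / 2) expR).
      apply: cvgB; last exact: cvg_cst.
      by apply: cvgM; [exact: cvg_cst|exact: cvg_id].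
    exact: continuous_expR.
  exact: cvg_cst.
have f0 u : 0 <= f u by rewrite /f le_max lexx orbT.
rewrite le_eqVlt; apply/orP; left; apply/eqP.
rewrite /np_excess /Rintegral; congr fine.
transitivity (\int[P]_w (f (ip (Z w) x))%:E)%E; first by [].
rewrite (gaussian_proj_integral x cf f0); apply: eq_integral => u _.
by rewrite /f exprMn sqr_sqrtr ?var_ge0// mulrA.
Qed.

Lemma gaussian_trig_test_bound (delta : H) (mu k : R) (f : H -> R) :
  (forall x, ip (C x) x <= 1 -> ip delta x <= mu) -> trig_test ip f ->
  \int[P]_w f (Z w + delta) - k * \int[P]_w f (Z w) <= np_excess k mu.
Proof.
move=> le_mu [tf f01].
pose S := [set ip delta x | x in [set x | v x <= 1]].
have v0 : v 0 = 0 by rewrite -(scale0r 0) varZ expr0n mul0r.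
have S0 : S 0 by exists 0; [rewrite /= v0|exact: ip0r].
have ubS : ubound S mu by move=> _ [x vx <-]; exact: le_mu.
have supS : has_sup S by split; [exists 0|exists mu].
(* [almost_riesz] needs near-maximizers, hence the exact supremum and not the bound [mu]. *)
pose s := sup S.
have s0 : 0 <= s by apply: ub_le_sup => //; exists mu.
have smu : s <= mu by apply: ge_sup => //; exists 0.
have le_s x : v x <= 1 -> ip delta x <= s.
  by move=> vx; apply: ub_le_sup; [exists mu|exists x].
have near_s e : 0 < e -> exists2 x, v x <= 1 & s - e < ip delta x.
  by move=> e0; have [_ [x vx <-] ?] := sup_adherent e0 supS; exists x.
have [ifd [K K0 hK]] := trig_test_shift delta s tf.
apply/ler_addgt0Pr => e e0.
have K1 : 0 < K + 1 by rewrite ltr_wpDl.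
pose t := e / (K + 1); have t0 : 0 < t by rewrite divr_gt0.
have [x vx hx] := almost_riesz s0 le_s near_s t0.
have [iLf hLf] := hK t x t0 hx.
have Kt : K * t <= e.
  by rewrite /t mulrCA ler_piMr// ?(ltW e0)// ler_pdivrMr// mul1r lerDl.
have [imax hmax] := excess_cm_density k s0 smu vx.
have mf : measurable_fun setT (fun w => f (Z w)).
  by apply: measurable_continuous_comp; exact: (continuous_trig Hip tf).
have if0 : P.-integrable setT (EFin \o (fun w => f (Z w))) by exact: integrable01.
have ikf : P.-integrable setT (EFin \o (fun w => k * f (Z w))).
  exact: eq_integrable (integrableZl measurableT k if0).
have h1 : \int[P]_w f (Z w + delta) <= \int[P]_w (cm_density s x w * f (Z w)) + e.
  by rewrite -lerBlDl (le_trans (ler_norm _))// (le_trans hLf).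
have h2 : \int[P]_w (cm_density s x w * f (Z w)) - k * \int[P]_w f (Z w) <= np_excess k mu.
  rewrite -RintegralZl// -RintegralB// (le_trans _ hmax)//; apply: le_Rintegral => //.
    exact: eq_integrable (integrableB measurableT iLf ikf).
  move=> w _; rewrite -mulrBl le_max.
  case/andP: (f01 (Z w)) => a0 a1.
  have [x0|x0] := leP 0 (cm_density s x w - k); first by rewrite ler_piMr.
  by rewrite mulr_le0_ge0 ?orbT// ltW.
lra.
Qed.

Hypothesis Hsep : separable_space H.

(** Approximation in [L^1] of the sum of the laws of [Z] and [Z + delta] controls both integrals by
    a single trigonometric test. The total error is at most [1 + k] times the distance, whence the
    precision [e / (1 + k)]. *)
Lemma gaussian_set_test_bound (delta : H) (mu k : R) (S : set (borel H)) :
  (forall x, ip (C x) x <= 1 -> ip delta x <= mu) -> 0 <= k -> measurable S ->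
  \int[P]_w \1_S (Z w + delta) - k * \int[P]_w \1_S (Z w) <= np_excess k mu.
Proof.
move=> le_mu k0 mS.
have mW := measurable_shift delta.
pose nu0 : {measure set (borel H) -> \bar R} :=
  measure_function_pushforward__canonical__measure_function_Measure P mZ.
pose nu1 : {measure set (borel H) -> \bar R} :=
  measure_function_pushforward__canonical__measure_function_Measure P mW.
pose m : {measure set (borel H) -> \bar R} := measure_add nu0 nu1.
have mE (F : borel H -> R) : measurable_fun setT F -> (forall z, 0 <= F z <= 1) ->
  (\int[m]_z (F z)%:E = (\int[P]_w F (Z w) + \int[P]_w F (Z w + delta))%:E)%E.
  move=> mF F01; have mFE : measurable_fun setT (EFin \o F) by exact/measurable_EFinP.
  have F0 z : (0 <= (EFin \o F) z)%E by rewrite lee_fin; case/andP: (F01 z).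
  rewrite (ge0_integral_measure_add nu0 nu1 measurableT (fun z _ => F0 z) mFE).
  rewrite (ge0_integral_pushforward mZ P measurableT mFE (fun z _ => F0 z)).
  rewrite (ge0_integral_pushforward mW P measurableT mFE (fun z _ => F0 z)).
  rewrite EFinD /Rintegral !fineK//; apply: integrable_fin_num => //.
  - by apply: integrable01 => //; exact: measurableT_comp mF mW.
  - by apply: integrable01 => //; exact: measurableT_comp mF mZ.
have mfin : (m setT < +oo)%E.
  have m1 := mE (cst 1) (measurable_cst _) (fun=> introT andP (conj ler01 (lexx _))).
  by rewrite -[m setT]mul1e -(integral_cst m measurableT 1%E) m1 ltry.
have [_ apS] := approx_set_borel Hip Hsep mfin mS.
apply/ler_addgt0Pr => e e0.
have K1 : 0 < 1 + k by rewrite ltr_pwDl.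
have [g gT gS] := apS (e / (1 + k)) (divr_gt0 e0 K1).
have mg := measurable_trig_test Hip gT.
have g01 : forall z, 0 <= g z <= 1 by case: gT.
have mi : measurable_fun setT (\1_S : borel H -> R) by exact: measurable_indic.
have i01 z : 0 <= (\1_S z : R) <= 1 by rewrite indicE; case: (_ \in _); rewrite lexx ler01.
have mdist : measurable_fun setT (fun z : borel H => `|\1_S z - g z|).
  by apply: measurableT_comp => //; exact: measurable_funB.
have dist01 z : 0 <= `|\1_S z - g z| <= 1.
  by rewrite normr_ge0/= ler_norml; have := i01 z; have := g01 z; lra.
rewrite /Rintegral (mE _ mdist dist01) [fine _]/= in gS.
have diff (V : Omega -> borel H) : measurable_fun setT V ->
    `|\int[P]_w \1_S (V w) - \int[P]_w g (V w)| <= \int[P]_w `|\1_S (V w) - g (V w)|.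
  move=> mV.
  have i1 : P.-integrable setT (EFin \o (fun w => \1_S (V w) : R)).
    by apply: integrable01 => //; exact: measurableT_comp mi mV.
  have i2 : P.-integrable setT (EFin \o (fun w => g (V w))).
    by apply: integrable01 => //; exact: measurableT_comp mg mV.
  rewrite -RintegralB//; apply: le_normr_Rintegral => //.
  exact: eq_integrable (integrableB measurableT i1 i2).
have d0 := diff _ mZ; have d1 := diff _ mW.
have := gaussian_trig_test_bound k le_mu gT.
set A1 := \int[P]_w \1_S (Z w + delta) in d1 *.
set A0 := \int[P]_w \1_S (Z w) in d0 *.
set G1 := \int[P]_w g (Z w + delta) in d1 *.
set G0 := \int[P]_w g (Z w) in d0 *.
set D0 := \int[P]_w `|_ - g (Z w)| in d0 gS.
set D1 := \int[P]_w `|_ - g (Z w + delta)| in d1 gS.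
move=> hG.
have D00 : 0 <= D0 by exact: Rintegral_ge0.
have D10 : 0 <= D1 by exact: Rintegral_ge0.
have h1 : A1 - G1 <= D1 by exact: le_trans (ler_norm _) d1.
have h0 : G0 - A0 <= D0 by rewrite (le_trans _ d0)// distrC ler_norm.
have h2 : k * (G0 - A0) <= k * D0 by rewrite ler_wpM2l.
have h3 : (1 + k) * (D0 + D1) <= e by rewrite mulrC -ler_pdivlMr.
have h4 : 0 <= k * D1 by rewrite mulr_ge0.
lra.
Qed.

End gaussian_vector.

(** * From indicators of sets to randomized tests *)

Section level_sets.
Context {R : realType}.
Implicit Types t : R.

(** For [t >= 0] this is the integer part of [t] truncated at [N], as a sum of indicators of
    superlevel conditions. *)
Let levels N t : R := \sum_(0 <= j < N) (j.+1%:R <= t)%R%:R.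

Lemma levels_le N t : 0 <= t -> levels N t <= t.
Proof.
move=> t0; elim: N => [|N ih]; first by rewrite /levels big_nil.
rewrite /levels big_nat_recr//=; have [Nt|tN] := leP N.+1%:R t; last by rewrite addr0.
apply: (le_trans _ Nt); rewrite -natr1 lerD2r.
rewrite (@le_trans _ _ (\sum_(0 <= j < N) 1))//.
  by apply: ler_sum => j _; rewrite lern1 leq_b1.
by rewrite big_const_nat iter_addr addr0 subn0.
Qed.

Lemma levels_ge N t : t <= N%:R -> t <= levels N t + 1.
Proof.
elim: N => [|N ih] tN; first by rewrite /levels big_nil add0r (le_trans tN).
have [tN'|Nt] := leP t N%:R.
  apply: (le_trans (ih tN')); rewrite lerD2r /levels big_nat_recr//= lerDl.
  exact: ler0n.
apply: (le_trans tN); rewrite -natr1 lerD2r /levels big_nat_recr//=.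
rewrite (@eq_big_nat _ _ _ _ _ _ (fun=> 1)); last first.
  move=> j /andP[_ jN]; suff -> : j.+1%:R <= t by [].
  by rewrite (le_trans _ (ltW Nt))// ler_nat.
by rewrite big_const_nat iter_addr addr0 subn0 lerDl ler0n.
Qed.

End level_sets.

Section gaussian_shift_tests.
Context (R : realType) (H : normedModType R) (ip : H -> H -> R).
Hypothesis Hip : is_inner_product ip.
Hypothesis Hsep : separable_space H.
Context d (Omega : measurableType d) (P : probability Omega R).
Variables (Z : Omega -> H) (C : H -> H).
Hypothesis HZ : centered_gaussian ip P Z C.

(** A layer-cake argument: [psi N / N.+1] is an average of indicators lying below [phi] by at most
    [1 / N.+1]. The bound for sets averages, and since [psi N <= N.+1 * phi], only the integral at
    [Z + delta] pays the rounding error. *)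
Lemma gaussian_test_bound (delta : H) (mu k : R) (phi : borel H -> R) :
  (forall x, ip (C x) x <= 1 -> ip delta x <= mu) -> 0 <= k ->
  measurable_fun setT phi -> (forall z, 0 <= phi z <= 1) ->
  \int[P]_w phi (Z w + delta) - k * \int[P]_w phi (Z w) <= np_excess k mu.
Proof.
move=> le_mu k0 mphi phi01.
have mZ : measurable_fun setT (Z : Omega -> borel H) by case: HZ.
have mW := measurable_shift HZ delta.
have Pfin : (P setT < +oo)%E by rewrite probability_setT ltry.
pose S (N j : nat) : set (borel H) := [set z | j.+1%:R <= N.+1%:R * phi z].
have mS N j : measurable (S N j).
  have m1 : measurable_fun setT (fun z => N.+1%:R * phi z) by exact: measurable_funM.
  rewrite (_ : S N j = (fun z => N.+1%:R * phi z) @^-1` `[j.+1%:R, +oo[).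
    by rewrite -[X in measurable X]setTI; apply: m1.
  by apply/seteqP; split => z; rewrite /S /= in_itv/= andbT.
pose psi N (z : borel H) : R := \sum_(0 <= j < N.+1) \1_(S N j) z.
have psiE N z : psi N z = \sum_(0 <= j < N.+1) (j.+1%:R <= N.+1%:R * phi z)%R%:R.
  apply: eq_bigr => j _; rewrite indicE; congr (nat_of_bool _)%:R.
  by apply/idP/idP; rewrite inE.
have psi_le N z : psi N z <= N.+1%:R * phi z.
  by rewrite psiE levels_le// mulr_ge0//; case/andP: (phi01 z).
have psi_ge N z : N.+1%:R * phi z <= psi N z + 1.
  by rewrite psiE levels_ge// ler_piMr//; case/andP: (phi01 z).
have bint (V : Omega -> borel H) (f : borel H -> R) K : measurable_fun setT V ->
    measurable_fun setT f -> (forall z, `|f z| <= K) ->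
    P.-integrable setT (EFin \o (fun w => f (V w))).
  move=> mV mf fK; apply: (bounded_integrable Pfin (K := K)) => //.
  exact: measurableT_comp mf mV.
have i1 A (V : Omega -> borel H) : measurable A -> measurable_fun setT V ->
    P.-integrable setT (EFin \o (fun w => \1_A (V w) : R)).
  move=> mA mV; apply: (bint V \1_A 1 mV) => // z.
  by rewrite indicE; case: (_ \in _); rewrite ?normr1 ?normr0.
have ipsi N n (V : Omega -> borel H) : measurable_fun setT V ->
    P.-integrable setT (EFin \o (fun w => \sum_(0 <= j < n) (\1_(S N j) (V w) : R))) /\
    \int[P]_w \sum_(0 <= j < n) \1_(S N j) (V w) =
      \sum_(0 <= j < n) \int[P]_w (\1_(S N j) (V w) : R).
  move=> mV; elim: n => [|n [ih1 ih2]].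
    under [X in integrable _ _ (EFin \o X)]eq_fun do rewrite big_nil.
    split; first exact: integrable0.
    rewrite big_nil; under eq_Rintegral do rewrite big_nil.
    by rewrite Rintegral_cst// mul0r.
  split.
    have := integrableD measurableT ih1 (i1 _ V (mS N n) mV).
    by apply: eq_integrable => // t _; rewrite /= big_nat_recr.
  under eq_Rintegral do rewrite big_nat_recr//=.
  by rewrite RintegralD// ?ih2 ?big_nat_recr//=; exact: i1.
have iphi (V : Omega -> borel H) : measurable_fun setT V ->
    P.-integrable setT (EFin \o (fun w => phi (V w))).
  by move=> mV; apply: (bint V phi 1) => // z; case/andP: (phi01 z) => ? ?; rewrite ger0_norm.
apply/ler_addgt0Pr => e e0.
have [N Ne] : exists N, N.+1%:R^-1 < e :> R.
  have /cvgrPdist_lt/(_ e e0)[N _ /(_ N (leqnn N))] := @cvg_harmonic R.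
  by rewrite sub0r normrN /= ger0_norm// => ?; exists N.
have N0 : 0 < N.+1%:R :> R by rewrite ltr0n.
have [ip1 e1] := ipsi N N.+1 _ mW; have [ip0 e0'] := ipsi N N.+1 _ mZ.
have up : N.+1%:R * \int[P]_w phi (Z w + delta) <= \int[P]_w psi N (Z w + delta) + 1.
  rewrite -RintegralZl//; last exact: iphi mW.
  rewrite -[1 in leRHS](_ : \int[P]_w (cst 1 w : R) = 1); last first.
    by rewrite Rintegral_cst//= (@probability_setT _ _ R P) mulr1.
  have ic : P.-integrable setT (EFin \o cst (1 : R)).
    exact: (finite_measure_integrable_cst P 1 measurableT).
  rewrite -RintegralD//; apply: le_Rintegral => //.
  - exact: eq_integrable (integrableZl measurableT N.+1%:R (iphi _ mW)).
  - exact: eq_integrable (integrableD measurableT ip1 ic).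
have lo : \int[P]_w psi N (Z w) <= N.+1%:R * \int[P]_w phi (Z w).
  rewrite -RintegralZl//; last exact: iphi mZ.
  apply: le_Rintegral => //.
  exact: eq_integrable (integrableZl measurableT N.+1%:R (iphi _ mZ)).
have mid : \int[P]_w psi N (Z w + delta) - k * \int[P]_w psi N (Z w) <=
    N.+1%:R * np_excess k mu.
  rewrite e1 e0' mulr_sumr -sumrB (@le_trans _ _ (\sum_(0 <= j < N.+1) np_excess k mu))//.
    by apply: ler_sum => j _; exact: (gaussian_set_test_bound Hip HZ Hsep le_mu k0 (mS N j)).
  by rewrite big_const_nat iter_addr addr0 subn0 mulr_natl.
have Ne' : 1 <= N.+1%:R * e.
  by rewrite -ler_pdivrMl// mulr1 ltW.
rewrite -(ler_pM2l N0) mulrBr mulrDr.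
have klo : k * \int[P]_w psi N (Z w) <= N.+1%:R * (k * \int[P]_w phi (Z w)).
  by rewrite mulrCA ler_wpM2l.
lra.
Qed.

End gaussian_shift_tests.

(** * Reduction of the mechanism to a shift of [Z] *)

Theorem theorem1 (R : realType)
  (H : completeNormedModType R) (ip : H -> H -> R)
  (Hip : is_inner_product ip) (Hsep : separable_space H)
  (d : measure_display) (Omega : measurableType d) (P : probability Omega R)
  (Z : Omega -> H) (C : H -> H) (HZ : centered_gaussian ip P Z C)
  (X : Type) (n : nat) (h : ('I_n -> X) -> H)
  (h_compat : forall D, (cm_norm ip C (h D) < +oo)%E)
  (h_sens : (sensitivity ip C h < +oo)%E)
  (mu : R) (mu_gt0 : 0 < mu) (sigma : R)
  (Hsigma : (sensitivity ip C h * (mu^-1)%:E <= sigma%:E)%E) :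
  is_GDP (@adjacent_datasets X n)
    (fun D => pushforward P ((fun w => h D + sigma *: Z w) : Omega -> borel H))
    mu.
Proof.
move=> D D' adjD alpha alpha01.
have mZ : measurable_fun setT (Z : Omega -> borel H) by case: HZ.
(* Oriented from the null law to the alternative; adjacency is symmetric, so the pair [(D', D)]
   enters the sensitivity. *)
pose eta := h D' - h D.
have adjD' : adjacent_datasets D' D.
  case: adjD => i [Di Dj]; exists i; split; first by move=> e; apply: Di.
  by move=> j ji; rewrite Dj.
have eta_sens x : ip (C x) x <= 1 -> ((ip eta x)%:E <= sensitivity ip C h)%E.
  move=> vx; apply: (@le_trans _ _ (cm_norm ip C eta)).
    by apply: ereal_sup_ubound; exists x.
  by apply: ereal_sup_ubound; exists (D', D).
have C0 : ip (C 0) 0 = 0 by rewrite (ip0r Hip).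
(* A supremum over no pairs would be [-oo]. The given adjacent pair, tested at [x = 0], excludes
   this, and with [h_sens] the sensitivity is a real number. *)
have sens0 : (0 <= sensitivity ip C h)%E.
  have := eta_sens 0; rewrite C0 (ip0r Hip); apply; exact: ler01.
have sens_fin : sensitivity ip C h \is a fin_num by rewrite ge0_fin_numE.
pose s := fine (sensitivity ip C h).
have sE : sensitivity ip C h = s%:E by rewrite fineK.
have s0 : 0 <= s by rewrite -lee_fin -sE.
have s_sigma : s <= sigma * mu.
  by move: Hsigma; rewrite sE -EFinM lee_fin ler_pdivrMr.
have sigma0 : 0 <= sigma by rewrite -(pmulr_lge0 _ mu_gt0) (le_trans s0).
have eta_le x : ip (C x) x <= 1 -> ip eta x <= sigma * mu.
  by move=> vx; rewrite (le_trans _ s_sigma)// -lee_fin -sE eta_sens.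
(* When [sigma = 0], [sigma^-1 = 0] makes [delta = 0], and [h D' = h D]. *)
pose delta := sigma^-1 *: eta.
have delta_le x : ip (C x) x <= 1 -> ip delta x <= mu.
  move=> vx; rewrite (ipZl Hip); have [->|sn0] := eqVneq sigma 0.
    by rewrite invr0 mul0r ltW.
  by rewrite ler_pdivrMl ?eta_le// lt_neqAle eq_sym sn0.
have hD' w : h D' + sigma *: Z w = h D + sigma *: (Z w + delta).
  rewrite scalerDr addrCA /delta scalerA.
  have [sig0|sn0] := eqVneq sigma 0; last first.
    have -> : h D' = h D + eta by rewrite /eta addrC subrK.
    by rewrite divff// scale1r addrC.
  suff -> : h D' = h D by rewrite sig0 mul0r !scale0r !addr0 ?add0r.
  (* Here [ip eta] is at most 0 on the unit ball of the covariance form; the positive multiple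
     [2 / (1 + v)] of [eta] lies in that ball, so the squared norm of [eta] is at most 0. *)
  apply/eqP; rewrite -subr_eq0 -normr_eq0 -sqrf_eq0 -(ip_norm Hip) -/eta.
  pose v := ip (C eta) eta.
  have v0 : 0 <= v by exact: (var_ge0 HZ).
  have p : 0 < 2 / (1 + v) by rewrite divr_gt0// ltr_pwDl.
  have := eta_le ((2 / (1 + v)) *: eta).
  have -> : ip (C ((2 / (1 + v)) *: eta)) ((2 / (1 + v)) *: eta) = (2 / (1 + v)) ^+ 2 * v.
    exact: (varZ Hip HZ).
  rewrite sig0 mul0r (ipZr Hip) pmulr_rle0// => eta0.
  rewrite eq_le {2}(ip_norm Hip) exprn_ge0// andbT eta0//.
  rewrite exprMn exprVn mulrAC ler_pdivrMr ?exprn_gt0 ?ltr_pwDl// mul1r.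
  by have := sqr_ge0 (1 - v); lra.
apply: le_ereal_inf_tmp => _ [phi [mphi phi01 phia] <-].
(* Pulling the test back along [z |-> h D + sigma *: z] turns the law at [D] into that of [Z] and,
   by [hD'], the law at [D'] into that of [Z + delta]. *)
pose psi : borel H -> R := fun z => phi (h D + sigma *: z : H).
have mpsi : measurable_fun setT psi.
  apply: (measurableT_comp mphi).
  apply: (@measurable_continuous_borelH _ _ (fun z : H => h D + sigma *: z)) => z.
  by apply: cvgD; [exact: cvg_cst|apply: cvgZ; [exact: cvg_cst|exact: cvg_id]].
have psi01 z : 0 <= psi z <= 1 by exact: phi01.
have push E (f : borel H -> R) : measurable_fun setT f -> (forall z, 0 <= f z) ->
    measurable_fun setT (E : Omega -> borel H) ->
    (\int[pushforward P E]_z (f z)%:E = \int[P]_w (f (E w))%:E)%E.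
  move=> mf f0 mE; have mfE : measurable_fun setT (EFin \o f) by exact/measurable_EFinP.
  have fE0 z : (0 <= (EFin \o f) z)%E by rewrite lee_fin.
  exact: (ge0_integral_pushforward mE P measurableT mfE (fun z _ => fE0 z)).
have mlaw D0 : measurable_fun setT ((fun w => h D0 + sigma *: Z w) : Omega -> borel H).
  apply: (measurableT_comp (f := fun z : borel H => (h D0 + sigma *: (z : H)) : borel H) _ mZ).
  apply: (@measurable_continuous_borelH _ _ (fun z : H => h D0 + sigma *: z)) => z.
  by apply: cvgD; [exact: cvg_cst|apply: cvgZ; [exact: cvg_cst|exact: cvg_id]].
have phi0 z : 0 <= phi z by case/andP: (phi01 z).
have ophi0 z : 0 <= 1 - phi z by rewrite subr_ge0; case/andP: (phi01 z).
have Pfin : (P setT < +oo)%E by rewrite probability_setT ltry.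
have mW := measurable_shift HZ delta.
have ipsi (V : Omega -> borel H) : measurable_fun setT V ->
    P.-integrable setT (EFin \o (fun w => psi (V w))).
  move=> mV; apply: (bounded_integrable Pfin (K := 1)).
    exact: measurableT_comp mpsi mV.
  by move=> w; case/andP: (psi01 (V w)) => ? ?; rewrite ger0_norm.
have typeI : \int[P]_w psi (Z w) <= alpha.
  rewrite -lee_fin /Rintegral fineK; last exact: integrable_fin_num (ipsi _ mZ).
  by move: phia; rewrite (push _ _ mphi phi0 (mlaw D)).
have typeII : (\int[pushforward P ((fun w => h D' + sigma *: Z w)%R : Omega -> borel H)]_z
    (1 - phi z)%:E = (1 - \int[P]_w psi (Z w + delta))%:E)%E.
  rewrite (push _ (fun z => 1 - phi z) _ ophi0 (mlaw D')); last exact: measurable_funB.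
  have <- : \int[P]_w (1 - psi (Z w + delta)) = 1 - \int[P]_w psi (Z w + delta).
    have ic : P.-integrable setT (EFin \o cst (1 : R)).
      exact: (finite_measure_integrable_cst P 1 measurableT).
    rewrite RintegralB//; last exact: ipsi mW.
    by rewrite Rintegral_cst//= (@probability_setT _ _ R P) mulr1.
  rewrite /Rintegral fineK.
    by apply: eq_integral => w _; rewrite hD'.
  have ic : P.-integrable setT (EFin \o cst (1 : R)).
    exact: (finite_measure_integrable_cst P 1 measurableT).
  apply: integrable_fin_num => //.
  exact: eq_integrable (integrableB measurableT ic (ipsi _ mW)).
rewrite typeII; apply: G_tradeoff_le => //.
  rewrite -lee_fin -typeII (push _ (fun z => 1 - phi z) _ ophi0 (mlaw D')).
    by apply: integral_ge0 => w; rewrite lee_fin ophi0.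
  exact: measurable_funB.
move=> k k0.
have := gaussian_test_bound Hip Hsep HZ delta_le (ltW k0) mpsi psi01.
have : k * \int[P]_w psi (Z w) <= k * alpha by rewrite ler_pM2l.
lra.
Qed.
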